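(* Let $k\ge 3$ be a constant. If there is a sequence of tautologies that do not have polynomial-size $\mathrm{EF}$-derivations from substitution instances of the tautologies $\alpha^{n^k}_n$, then $\mathrm{SAT}_n\notin\mathrm{Circuit}[n^k]$ for infinitely many $n$.
   Context: $\mathrm{EF}$ is the Extended Frege proof system. $\mathrm{SAT}_n(x,y)$ is a polynomial-time predicate saying that $x$ is an $n$-bit string encoding a propositional formula satisfied by assignment $y$, and $\mathrm{SAT}_n(z)\in\{0,1\}$ equals $1$ iff $\exists y\,\mathrm{SAT}_n(z,y)$. $\mathrm{Circuit}[s]$ is the set of single-output fan-in-two circuits with $n$ inputs and size at most $s$. (Lipton–Young) For sufficiently large $n$, if a Boolean function $g$ on $n$ inputs is not computable by circuits of size $s^3$, $s\ge n^3$, there is a set $A^{g,s}_n\subseteq\{0,1\}^n$ of size $\mathrm{poly}(s)$ (''anticheckers'') such that no circuit of size $s$ computes $g$ correctly on all of $A^{g,s}_n$. For sufficiently large $n$, the tautology $\alpha^s_n$ is $$\big(\mathrm{SAT}_n(x,y)\rightarrow\mathrm{SAT}_n(x,B(x))\big)\vee\Big(\bigvee_{z\in A}C(z)\ne \mathrm{SAT}_n(z)\Big),$$ where: $A=A^{\mathrm{SAT}_n,s}_n$ if $\mathrm{SAT}_n\notin\mathrm{Circuit}[s^3]$, and otherwise $A$ is an arbitrary $\mathrm{poly}(s)$-size subset of $\{0,1\}^n$; $C$ is a single-output circuit of size $s$ represented by free variables; $x,y$ are free $n$-bit strings; the values $\mathrm{SAT}_n(z)$ for $z\in A$ are fixed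 bits; and $B$ is a fixed $\mathrm{poly}(s)$-size circuit with $n$ inputs and at most $n$ outputs obtained in a standard way from a fixed $s^3$-size single-output circuit $B'$ with $\mathrm{SAT}_n\in\mathrm{Circuit}[s^3]\Leftrightarrow\forall x\in\{0,1\}^n\,B'(x)=\mathrm{SAT}_n(x)$, such that $B$ solves the search version of $\mathrm{SAT}_n$ whenever $\mathrm{SAT}_n\in\mathrm{Circuit}[s^3]$. *)

(* Defs.v *)
From HB Require Import structures.
From mathcomp Require Import all_boot.

Set Implicit Arguments.
Unset Strict Implicit.
Unset Printing Implicit Defensive.

(** * Propositional formulas in the De Morgan language *)

Inductive form (V : Type) : Type :=
  | Var of V
  | Top
  | Bot
  | Neg of form V
  | And of form V & form V
  | Or of form V & form V.

Arguments Top {V}.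
Arguments Bot {V}.

Section Formulas.
Variable V : Type.
Implicit Types f g : form V.

Definition Imp f g := Or (Neg f) g.
Definition Equiv f g := And (Imp f g) (Imp g f).
Definition Const (b : bool) : form V := if b then Top else Bot.
Definition Lit (b : bool) f := if b then f else Neg f.
Definition bigAnd (fs : seq (form V)) := foldr (@And V) Top fs.
Definition bigOr (fs : seq (form V)) := foldr (@Or V) Bot fs.

Fixpoint eval (v : V -> bool) f : bool :=
  match f with
  | Var p => v p
  | Top => true
  | Bot => false
  | Neg g => ~~ eval v g
  | And g h => eval v g && eval v h
  | Or g h => eval v g || eval v h
  end.

Definition tautology f := forall v, eval v f.

(* The number of symbols of a formula. *)
Fixpoint fsize f : nat :=
  match f with
  | Var _ | Top | Bot => 1
  | Neg g => (fsize g).+1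
  | And g h | Or g h => (fsize g + fsize h).+1
  end.

Fixpoint subst (W : Type) (s : V -> form W) f : form W :=
  match f with
  | Var p => s p
  | Top => Top
  | Bot => Bot
  | Neg g => Neg (subst s g)
  | And g h => And (subst s g) (subst s h)
  | Or g h => Or (subst s g) (subst s h)
  end.

End Formulas.

Fixpoint occurs (q : nat) (f : form nat) : bool :=
  match f with
  | Var p => p == q
  | Top | Bot => false
  | Neg g => occurs q g
  | And g h | Or g h => occurs q g || occurs q h
  end.

(** * Extended Frege *)

Inductive frege_axiom : form nat -> Prop :=
  | ax_K f g : frege_axiom (Imp f (Imp g f))
  | ax_S f g h :
      frege_axiom (Imp (Imp f (Imp g h)) (Imp (Imp f g) (Imp f h)))
  | ax_and_intro f g : frege_axiom (Imp f (Imp g (And f g)))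
  | ax_and_left f g : frege_axiom (Imp (And f g) f)
  | ax_and_right f g : frege_axiom (Imp (And f g) g)
  | ax_or_left f g : frege_axiom (Imp f (Or f g))
  | ax_or_right f g : frege_axiom (Imp g (Or f g))
  | ax_or_elim f g h :
      frege_axiom (Imp (Imp f h) (Imp (Imp g h) (Imp (Or f g) h)))
  | ax_neg_intro f g : frege_axiom (Imp (Imp f g) (Imp (Imp f (Neg g)) (Neg f)))
  | ax_neg_elim f : frege_axiom (Imp (Neg (Neg f)) f)
  | ax_top : frege_axiom Top
  | ax_bot f : frege_axiom (Imp Bot f).

(* [f] may be written after the lines [prev] in a derivation of [goal] from
   the set of hypotheses [H].  In the extension rule the variable [q] is new:
   it occurs neither in [D], nor in [prev], nor in [goal]. *)
Inductive EF_step (H : form nat -> Prop) (goal : form nat)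
    (prev : seq (form nat)) : form nat -> Prop :=
  | EF_axiom f : frege_axiom f -> EF_step H goal prev f
  | EF_hyp f : H f -> EF_step H goal prev f
  | EF_mp i j f : i < size prev -> j < size prev ->
      nth Top prev j = Imp (nth Top prev i) f -> EF_step H goal prev f
  | EF_ext q D : ~~ occurs q D -> ~~ has (occurs q) prev -> ~~ occurs q goal ->
      EF_step H goal prev (Equiv (Var q) D).

Definition EF_derivation (H : form nat -> Prop) (p : seq (form nat))
    (goal : form nat) : Prop :=
  [/\ 0 < size p, last Top p = goal &
      forall i, i < size p -> EF_step H goal (take i p) (nth Top p i)].

Definition derivation_size (p : seq (form nat)) : nat := sumn (map (@fsize nat) p).

(* Every polynomial is dominated on [nat] by [poly_bound c] for some [c]. *)
Definition poly_bound (c m : nat) : nat := m ^ c + c.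

Definition poly_size_derivations (H : form nat -> Prop)
    (phi : nat -> form nat) : Prop :=
  exists c, forall i, exists p,
    EF_derivation H p (phi i) /\ derivation_size p <= poly_bound c (fsize (phi i)).

(** * Boolean circuits *)

(* Gates point to wires: on [n] inputs, wires [0 .. n-1] are the inputs and
   wire [n + g] is the output of gate [g]. *)
Inductive gate :=
  | GNot of nat
  | GAnd of nat & nat
  | GOr of nat & nat.

Record circuit := Circuit { gates : seq gate; outs : seq nat }.

Definition gate_wf (m : nat) (a : gate) : bool :=
  match a with
  | GNot i => i < m
  | GAnd i j | GOr i j => (i < m) && (j < m)
  end.

Definition circuit_wf (n : nat) (C : circuit) : bool :=
  all (fun g => gate_wf (n + g) (nth (GNot 0) (gates C) g))
      (iota 0 (size (gates C)))
  && all (fun o => o < n + size (gates C)) (outs C).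

Definition csize (C : circuit) : nat := size (gates C).

Definition gate_val (vs : seq bool) (a : gate) : bool :=
  match a with
  | GNot i => ~~ nth false vs i
  | GAnd i j => nth false vs i && nth false vs j
  | GOr i j => nth false vs i || nth false vs j
  end.

Definition wire_vals (C : circuit) (x : seq bool) : seq bool :=
  foldl (fun vs a => rcons vs (gate_val vs a)) x (gates C).

Definition ceval (C : circuit) (x : seq bool) : seq bool :=
  [seq nth false (wire_vals C x) o | o <- outs C].

Definition ceval1 (C : circuit) (x : seq bool) : bool := head false (ceval C x).

Definition single_output (n s : nat) (C : circuit) : Prop :=
  [/\ circuit_wf n C, size (outs C) = 1 & csize C <= s].

Definition in_Circuit (n s : nat) (g : n.-tuple bool -> bool) : Prop :=
  exists2 C, single_output n s C & forall x : n.-tuple bool, ceval1 C x = g x.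

(** * Satisfiability *)

(* A formula is written in postfix notation over eight symbols of three bits
   each; the variable of index [i] is written as [i] ticks followed by [TVar].
   An [n]-bit string is read as [n %/ 3] symbols, the at most two remaining
   bits being ignored.  [TPad] is skipped, so that fixing a variable to a
   constant can be done without changing the length. *)
Inductive token := TPad | TTick | TVar | TTop | TBot | TNeg | TAnd | TOr.

Definition tokens := [:: TPad; TTick; TVar; TTop; TBot; TNeg; TAnd; TOr].

Definition token_bits (k : token) : bool * bool * bool :=
  match k with
  | TPad => (false, false, false)
  | TTick => (false, false, true)
  | TVar => (false, true, false)
  | TTop => (false, true, true)
  | TBot => (true, false, false)
  | TNeg => (true, false, true)
  | TAnd => (true, true, false)
  | TOr => (true, true, true)
  end.

Definition token_of_bits (a b c : bool) : token :=
  match a, b, c with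
  | false, false, false => TPad
  | false, false, true => TTick
  | false, true, false => TVar
  | false, true, true => TTop
  | true, false, false => TBot
  | true, false, true => TNeg
  | true, true, false => TAnd
  | true, true, true => TOr
  end.

Definition read_tokens (n : nat) (x : seq bool) : seq token :=
  [seq token_of_bits (nth false x (3 * t)) (nth false x (3 * t).+1)
                     (nth false x (3 * t).+2) | t <- iota 0 (n %/ 3)].

(* [i] counts the ticks read since the last symbol other than a tick or a
   padding, [st] is the stack of parsed subformulas. *)
Fixpoint parse (i : nat) (st : seq (form nat)) (ts : seq token) :
    option (form nat) :=
  match ts with
  | [::] => if st is [:: f] then Some f else None
  | TPad :: ts' => parse i st ts'
  | TTick :: ts' => parse i.+1 st ts'
  | TVar :: ts' => parse 0 (Var i :: st) ts'
  | TTop :: ts' => parse 0 (Top :: st) ts'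
  | TBot :: ts' => parse 0 (Bot :: st) ts'
  | TNeg :: ts' => if st is f :: st' then parse 0 (Neg f :: st') ts' else None
  | TAnd :: ts' =>
      if st is g :: f :: st' then parse 0 (And f g :: st') ts' else None
  | TOr :: ts' =>
      if st is g :: f :: st' then parse 0 (Or f g :: st') ts' else None
  end.

Definition decode (n : nat) (x : seq bool) : option (form nat) :=
  parse 0 [::] (read_tokens n x).

Definition SAT (n : nat) (x y : n.-tuple bool) : bool :=
  if decode n x is Some f then eval (nth false y) f else false.

Definition SATn (n : nat) (x : n.-tuple bool) : bool :=
  [exists y : n.-tuple bool, SAT x y].

(** * The formulas alpha *)

(* Circuit computations are expressed in formulas by auxiliary variables: a
   computation is a list of pairs [(v, d)], the auxiliary variable [v] being
   defined by [d] from variables defined before it. *)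
Definition with_defs (V : Type) (ds : seq (V * form V)) (f : form V) : form V :=
  foldr (fun d acc => Imp (Equiv (Var d.1) d.2) acc) f ds.

(* Auxiliary variables for [SAT_n(x,y)], which runs [parse] with truth values
   of subformulas on the stack (cell 0 is the top); [t] symbols have been read:
     [SIdx t i] : the tick counter is [i];
     [SOk t]    : no operator has been applied to too short a stack;
     [SOcc t j] : cell [j] is occupied;
     [SVal t j] : the truth value in cell [j]. *)
Inductive satvar :=
  | SIdx of nat & nat
  | SOk of nat
  | SOcc of nat & nat
  | SVal of nat & nat.

Section SatFormula.
Variables (V : Type) (n : nat) (x y : nat -> form V) (aux : satvar -> V).

Let T := n %/ 3.

Definition is_token (t : nat) (k : token) : form V :=
  let: (a, b, c) := token_bits k in
  And (Lit a (x (3 * t))) (And (Lit b (x (3 * t).+1)) (Lit c (x (3 * t).+2))).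

Definition token_case (t : nat) (F : token -> form V) : form V :=
  bigOr [seq And (is_token t k) (F k) | k <- tokens].

Definition tick_idx t i : form V := if i < T then Var (aux (SIdx t i)) else Bot.
Definition cell_occ t j : form V := if j < T then Var (aux (SOcc t j)) else Bot.
Definition cell_val t j : form V := if j < T then Var (aux (SVal t j)) else Bot.

Definition next_idx t i (k : token) : form V :=
  match k with
  | TPad => tick_idx t i
  | TTick => if i is i'.+1 then tick_idx t i' else Bot
  | _ => Const V (i == 0)
  end.

Definition next_ok t (k : token) : form V :=
  match k with
  | TNeg => cell_occ t 0
  | TAnd | TOr => cell_occ t 1
  | _ => Top
  end.

Definition next_occ t j (k : token) : form V :=
  match k with
  | TPad | TTick | TNeg => cell_occ t j
  | TVar | TTop | TBot => if j is j'.+1 then cell_occ t j' else Top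
  | TAnd | TOr => cell_occ t j.+1
  end.

Definition read_var t : form V := bigOr [seq And (tick_idx t i) (y i) | i <- iota 0 T].

Definition next_val t j (k : token) : form V :=
  match k, j with
  | TPad, _ | TTick, _ => cell_val t j
  | TVar, 0 => read_var t
  | TTop, 0 => Top
  | TBot, 0 => Bot
  | TVar, j'.+1 | TTop, j'.+1 | TBot, j'.+1 => cell_val t j'
  | TNeg, 0 => Neg (cell_val t 0)
  | TNeg, _ => cell_val t j
  | TAnd, 0 => And (cell_val t 1) (cell_val t 0)
  | TOr, 0 => Or (cell_val t 1) (cell_val t 0)
  | TAnd, _ | TOr, _ => cell_val t j.+1
  end.

Definition sat_init : seq (V * form V) :=
  (aux (SOk 0), Top) ::
  [seq (aux (SIdx 0 i), Const V (i == 0)) | i <- iota 0 T] ++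
  [seq (aux (SOcc 0 j), Bot) | j <- iota 0 T] ++
  [seq (aux (SVal 0 j), Bot) | j <- iota 0 T].

Definition sat_step (t : nat) : seq (V * form V) :=
  (aux (SOk t.+1), And (Var (aux (SOk t))) (token_case t (next_ok t))) ::
  [seq (aux (SIdx t.+1 i), token_case t (next_idx t i)) | i <- iota 0 T] ++
  [seq (aux (SOcc t.+1 j), token_case t (next_occ t j)) | j <- iota 0 T] ++
  [seq (aux (SVal t.+1 j), token_case t (next_val t j)) | j <- iota 0 T].

Definition sat_defs : seq (V * form V) :=
  sat_init ++ flatten [seq sat_step t | t <- iota 0 T].

Definition sat_out : form V :=
  And (Var (aux (SOk T))) (And (cell_occ T 0) (And (Neg (cell_occ T 1)) (cell_val T 0))).

End SatFormula.

(* Variables of alpha: the free strings [x] and [y]; auxiliary variables for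
   [SAT_n(x,y)] and [SAT_n(x,B(x))]; the gates of [B] on [x]; the description
   of [C]; the gates of [C] on each [z].  In the description of [C],
   [VCneg g] says that gate [g] is a negation and otherwise [VCand g] whether
   it is a conjunction or a disjunction; [VCleft g w], [VCright g w] and [VCout w]
   say that the left and right input of gate [g] and the output is wire [w]. *)
Inductive avar :=
  | VX of nat
  | VY of nat
  | VSatY of satvar
  | VSatB of satvar
  | VB of nat
  | VCneg of nat
  | VCand of nat
  | VCleft of nat & nat
  | VCright of nat & nat
  | VCout of nat
  | VCval of seq bool & nat.

Section Alpha.
Variables (n s : nat).

Definition fX (i : nat) : form avar := Var (VX i).
Definition fY (i : nat) : form avar := Var (VY i).

Section CircuitB.
Variable B : circuit.

Definition B_wire (w : nat) : form avar :=
  if w < n then Var (VX w) else Var (VB (w - n)).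

Definition B_gate (a : gate) : form avar :=
  match a with
  | GNot i => Neg (B_wire i)
  | GAnd i j => And (B_wire i) (B_wire j)
  | GOr i j => Or (B_wire i) (B_wire j)
  end.

Definition B_defs : seq (avar * form avar) :=
  [seq (VB g, B_gate (nth (GNot 0) (gates B) g)) | g <- iota 0 (csize B)].

Definition fB (i : nat) : form avar :=
  if i < size (outs B) then B_wire (nth 0 (outs B) i) else Bot.

End CircuitB.

Definition exactly_one (m : nat) (p : nat -> form avar) : form avar :=
  And (bigOr [seq p i | i <- iota 0 m])
      (bigAnd [seq Neg (And (p i) (p j)) | j <- iota 0 m, i <- iota 0 j]).

Definition C_valid : form avar :=
  And (bigAnd [seq And (exactly_one (n + g) (fun w => Var (VCleft g w)))
                       (exactly_one (n + g) (fun w => Var (VCright g w)))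
              | g <- iota 0 s])
      (exactly_one (n + s) (fun w => Var (VCout w))).

Definition C_wire (z : seq bool) (w : nat) : form avar :=
  if w < n then Const avar (nth false z w) else Var (VCval z (w - n)).

Definition C_select (z : seq bool) (m : nat) (p : nat -> avar) : form avar :=
  bigOr [seq And (Var (p w)) (C_wire z w) | w <- iota 0 m].

Definition C_gate (z : seq bool) (g : nat) : form avar :=
  let l := C_select z (n + g) (VCleft g) in
  let r := C_select z (n + g) (VCright g) in
  let neg := Var (VCneg g) in
  let con := Var (VCand g) in
  Or (And neg (Neg l))
     (And (Neg neg) (Or (And con (And l r)) (And (Neg con) (Or l r)))).

Definition C_defs (z : seq bool) : seq (avar * form avar) :=
  [seq (VCval z g, C_gate z g) | g <- iota 0 s].

Definition fC (z : seq bool) : form avar := C_select z (n + s) VCout.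

Definition alpha (A : {set n.-tuple bool}) (B : circuit) : form avar :=
  with_defs
    (B_defs B ++ sat_defs n fX fY VSatY ++ sat_defs n fX (fB B) VSatB ++
     flatten [seq C_defs (tval z) | z <- enum A])
    (Imp C_valid
      (Or (Imp (sat_out n VSatY) (sat_out n VSatB))
          (bigOr [seq Neg (Equiv (fC (tval z)) (Const avar (SATn z)))
                 | z <- enum A]))).

(** * The parameters of alpha *)

Definition anticheckers (g : n.-tuple bool -> bool) (A : {set n.-tuple bool}) :
    Prop :=
  ~ exists2 C, single_output n s C &
      forall z : n.-tuple bool, z \in A -> ceval1 C z = g z.

Definition antichecker_choice (c : nat) (A : {set n.-tuple bool}) : Prop :=
  #|A| <= poly_bound c s /\
  (~ in_Circuit (s ^ 3) (@SATn n) -> anticheckers (@SATn n) A).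

Definition decider_choice (B' : circuit) : Prop :=
  single_output n (s ^ 3) B' /\
  (in_Circuit (s ^ 3) (@SATn n) <->
   forall x : n.-tuple bool, ceval1 B' x = SATn x).

(* Missing outputs are read as zeros. *)
Definition output_string (B : circuit) (x : seq bool) : n.-tuple bool :=
  [tuple nth false (ceval B x) i | i < n].

Definition solves_search (B : circuit) : Prop :=
  forall x y : n.-tuple bool, SAT x y -> SAT x (output_string B x).

(* The search-to-decision reduction producing [B] from [B'] enters only through
   what it guarantees: [B] solves the search problem if [B'] decides [SAT_n],
   i.e. by [decider_choice] if [SAT_n] is in [Circuit[s^3]]. *)
Definition searcher_choice (c : nat) (B' B : circuit) : Prop :=
  [/\ circuit_wf n B, size (outs B) <= n, csize B <= poly_bound c s &
      (forall x : n.-tuple bool, ceval1 B' x = SATn x) -> solves_search B].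

End Alpha.

Definition alpha_instance (k n0 : nat) (A : forall n, {set n.-tuple bool})
    (B : nat -> circuit) (f : form nat) : Prop :=
  exists n (sigma : avar -> form nat),
    n0 <= n /\ f = subst sigma (alpha (n ^ k) (A n) (B n)).

(* Main.v *)
Require Import Defs.
From mathcomp Require Import all_boot.
From mathcomp Require Import zify.
From Stdlib Require Import Classical.

Set Implicit Arguments.
Unset Strict Implicit.
Unset Printing Implicit Defensive.

(** Suppose that [SAT_n] has circuits of size [n^k] for all large [n].  Given a
    tautology [phi], take [n] polynomial in its size, and in [alpha] substitute
    for [x] the code of the negation of [phi], for [y] the variables of [phi],
    for [C] the description of a circuit deciding [SAT_n], and for the auxiliary
    variables of [SAT_n(x,y)] the subformulas that the parser has on its stack.
    All other variables become truth values.  Every definition in the instance is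
    then settled by propagating constants, and so is the rest: the circuit [C] is
    correct on [A], and [SAT_n(x,B(x))] is false because the negation of [phi]
    is unsatisfiable.  What remains is the double negation of [phi].  Constant
    propagation uses finitely many schemas per connective, which makes the
    derivation polynomial; no extension variable is needed. *)

(** * Completeness of the Frege rules *)

Inductive derivable (G : form nat -> Prop) : form nat -> Prop :=
  | derivable_axiom f : frege_axiom f -> derivable G f
  | derivable_hyp f : G f -> derivable G f
  | derivable_mp f g : derivable G (Imp f g) -> derivable G f -> derivable G g.

Section Completeness.
Implicit Types (G : form nat -> Prop) (f g h : form nat) (v : nat -> bool).

Definition add_hyp G f : form nat -> Prop := fun h => h = f \/ G h.

Lemma derivable_sub G G' f :
  (forall h, G h -> G' h) -> derivable G f -> derivable G' f.
Proof.
move=> sGG'; elim=> {f} [f ax|f Gf|f g _ IHfg _ IHf].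
- exact: derivable_axiom.
- exact/derivable_hyp/sGG'.
- exact: derivable_mp IHfg IHf.
Qed.

Lemma derivable_K G f g : derivable G g -> derivable G (Imp f g).
Proof. by apply: derivable_mp; apply: derivable_axiom; apply: ax_K. Qed.

Lemma derivable_imp_refl G f : derivable G (Imp f f).
Proof.
apply: (@derivable_mp _ (Imp f (Imp f f))); last first.
  exact/derivable_axiom/ax_K.
apply: (@derivable_mp _ (Imp f (Imp (Imp f f) f))); last first.
  exact/derivable_axiom/ax_K.
exact/derivable_axiom/ax_S.
Qed.

Lemma deduction G f g : derivable (add_hyp G f) g -> derivable G (Imp f g).
Proof.
elim=> {g} [g ax|g [->|Gg]|g h _ IHgh _ IHg].
- exact/derivable_K/derivable_axiom.
- exact: derivable_imp_refl.
- exact/derivable_K/derivable_hyp.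
- apply: derivable_mp IHg; apply: derivable_mp IHgh.
  exact/derivable_axiom/ax_S.
Qed.

Lemma derivable_not_intro G f g :
  derivable G (Imp f g) -> derivable G (Imp f (Neg g)) -> derivable G (Neg f).
Proof.
move=> dg dng; apply: derivable_mp dng; apply: derivable_mp dg.
exact/derivable_axiom/ax_neg_intro.
Qed.

Lemma derivable_not_bot G : derivable G (Neg Bot).
Proof.
by apply: (@derivable_not_intro _ _ Top); apply: derivable_axiom; apply: ax_bot.
Qed.

Lemma derivable_or_elim G f g h :
  derivable G (Imp f h) -> derivable G (Imp g h) -> derivable G (Imp (Or f g) h).
Proof.
move=> df dg; apply: derivable_mp dg; apply: derivable_mp df.
exact/derivable_axiom/ax_or_elim.
Qed.

Lemma derivable_cases G f g :
  derivable (add_hyp G f) g -> derivable (add_hyp G (Neg f)) g -> derivable G g.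
Proof.
move=> /deduction df /deduction dnf.
(* [Imp f f] unfolds to [Or (Neg f) f], which is excluded middle. *)
exact: derivable_mp (derivable_or_elim dnf df) (derivable_imp_refl G f).
Qed.

(** Kalmár's lemma: induction on [f] follows the truth tables, each row of which is derivable from
    the axioms for the connective. *)
Lemma derivable_lit G v f :
  (forall p, occurs p f -> derivable G (Lit (v p) (Var p))) ->
  derivable G (Lit (eval v f) f).
Proof.
elim: f => [p|||f IHf|f IHf g IHg|f IHf g IHg] /= dG.
- by apply: dG; rewrite eqxx.
- exact/derivable_axiom/ax_top.
- exact: derivable_not_bot.
- move: (IHf dG); case: (eval v f) => //= df.
  by apply: (@derivable_not_intro _ _ f); [exact: derivable_K|exact: derivable_imp_refl].
- have {IHf} := IHf (fun p op => dG p (introT orP (or_introl op))).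
  have {IHg} := IHg (fun p op => dG p (introT orP (or_intror op))).
  case: (eval v f) => /= dg df; last first.
    apply: (@derivable_not_intro _ _ f); last exact: derivable_K.
    exact/derivable_axiom/ax_and_left.
  case: (eval v g) dg => /= dg; last first.
    apply: (@derivable_not_intro _ _ g); last exact: derivable_K.
    exact/derivable_axiom/ax_and_right.
  apply: derivable_mp dg; apply: derivable_mp df.
  exact/derivable_axiom/ax_and_intro.
- have {IHf} := IHf (fun p op => dG p (introT orP (or_introl op))).
  have {IHg} := IHg (fun p op => dG p (introT orP (or_intror op))).
  case: (eval v f) => /= dg df.
    by apply: derivable_mp df; apply/derivable_axiom/ax_or_left.
  case: (eval v g) dg => /= dg.
    by apply: derivable_mp dg; apply/derivable_axiom/ax_or_right.
  (* [Imp h Bot] is the disjunction [Or (Neg h) Bot], so its first disjunct suffices. *)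
  have toBot h : derivable G (Neg h) -> derivable G (Imp h Bot).
    by apply: derivable_mp; apply/derivable_axiom/ax_or_left.
  apply: (@derivable_not_intro _ _ Bot); last exact/derivable_K/derivable_not_bot.
  by apply: derivable_or_elim; apply: toBot.
Qed.

Definition literals v l : form nat -> Prop :=
  fun h => exists2 p, p < l & h = Lit (v p) (Var p).

(** Variables are eliminated one at a time from the top: a case distinction on [Var l] merges the
    two valuations that agree with [v] below [l] and differ at [l]. *)
Lemma derivable_literals_elim l G f :
  (forall v, derivable (literals v l) f) -> derivable G f.
Proof.
elim: l => [|l IHl] d.
  by apply: derivable_sub (d predT) => h [p]; rewrite ltn0.
apply: IHl => v; apply: (@derivable_cases _ (Var l)).
  apply: derivable_sub (d (fun p => (p == l) || v p)) => h [p lt_p ->].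
  case: eqVneq => [->|ne_pl]; first by left.
  by right; exists p => //; rewrite ltn_neqAle ne_pl -ltnS.
apply: derivable_sub (d (fun p => (p != l) && v p)) => h [p lt_p ->].
case: eqVneq => [->|ne_pl]; first by left.
by right; exists p => //; rewrite ltn_neqAle ne_pl -ltnS.
Qed.

Lemma occurs_bounded f : exists l, forall p, occurs p f -> p < l.
Proof.
elim: f => [q|||f IHf|f [l IHf] g [m IHg]|f [l IHf] g [m IHg]] //=;
  try by exists 0.
- by exists q.+1 => p /eqP->.
- by exists (l + m) => p /orP[/IHf|/IHg] ?; lia.
- by exists (l + m) => p /orP[/IHf|/IHg] ?; lia.
Qed.

Lemma completeness G f : tautology f -> derivable G f.
Proof.
move=> tf; have [l bl] := occurs_bounded f.
apply: (@derivable_literals_elim l) => v.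
have := @derivable_lit (literals v l) v f; rewrite tf /=; apply=> p op.
by apply: derivable_hyp; exists p => //; apply: bl.
Qed.

End Completeness.

(** * Derivations with bounded number and size of lines *)

Section Bounded.
Variables (H : form nat -> Prop).

(** Tree-like proofs without the extension rule. [L] bounds the number of lines and [M] the size of
    the leaves; modus ponens passes to a subformula of a premise, so [M] bounds every line. *)
Inductive bounded (M : nat) : nat -> form nat -> Prop :=
  | bounded_axiom L f : frege_axiom f -> 0 < L -> fsize f <= M -> bounded M L f
  | bounded_hyp L f : H f -> 0 < L -> fsize f <= M -> bounded M L f
  | bounded_mp L L1 L2 f g : bounded M L1 (Imp f g) -> bounded M L2 f ->
      L1 + L2 < L -> bounded M L g.

Lemma bounded_weaken M L M' L' f :
  M <= M' -> L <= L' -> bounded M L f -> bounded M' L' f.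
Proof.
move=> leM leL b; elim: b L' leL => {L f}.
- by move=> L f ax L0 sf L' leL; apply: bounded_axiom => //; lia.
- by move=> L f hf L0 sf L' leL; apply: bounded_hyp => //; lia.
- move=> L L1 L2 f g _ IH1 _ IH2 ltL L' leL.
  by apply: (bounded_mp (IH1 _ (leqnn _)) (IH2 _ (leqnn _))); lia.
Qed.

(** With no extension rule there is no freshness condition, so this property, unlike [EF_step], does
    not mention the goal and survives concatenation. *)
Definition inferred (p : seq (form nat)) (i : nat) : Prop :=
  [\/ frege_axiom (nth Top p i), H (nth Top p i) |
      exists a b, [/\ a < i, b < i & nth Top p b = Imp (nth Top p a) (nth Top p i)]].

Lemma inferred_cat p1 p2 :
  (forall i, i < size p1 -> inferred p1 i) ->
  (forall i, i < size p2 -> inferred p2 i) ->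
  forall i, i < size (p1 ++ p2) -> inferred (p1 ++ p2) i.
Proof.
move=> d1 d2 i; rewrite size_cat => lti.
have [lt1|ge1] := ltnP i (size p1).
  have [ax|hf|[a [b [la lb e]]]] := d1 _ lt1.
  - by apply: Or31; rewrite nth_cat lt1.
  - by apply: Or32; rewrite nth_cat lt1.
  - apply: Or33; exists a, b; split=> //.
    by rewrite !nth_cat lt1 (ltn_trans la lt1) (ltn_trans lb lt1).
have lt2 : i - size p1 < size p2 by lia.
have nlt1 : i < size p1 = false by lia.
have [ax|hf|[a [b [la lb e]]]] := d2 _ lt2.
- by apply: Or31; rewrite nth_cat nlt1.
- by apply: Or32; rewrite nth_cat nlt1.
- apply: Or33; exists (size p1 + a), (size p1 + b); split; [lia|lia|].
  by rewrite !nth_cat nlt1 !ltnNge !leq_addr /= !addKn.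
Qed.

(** The proof tree is written out in postorder: the lines for the implication, the lines for its
    premise, then the conclusion. *)
Lemma bounded_lines M L f : bounded M L f ->
  exists p, [/\ size p <= L, all (fun g => fsize g <= M) p,
    forall i, i < size p -> inferred p i & exists p', p = rcons p' f].
Proof.
elim=> {L f}.
- move=> L f ax L0 sf; exists [:: f]; split=> //=; first by rewrite sf.
    by case=> // _; apply: Or31.
  by exists [::].
- move=> L f hf L0 sf; exists [:: f]; split=> //=; first by rewrite sf.
    by case=> // _; apply: Or32.
  by exists [::].
move=> L L1 L2 f g _ [p1 [s1 a1 i1 [q1 e1]]] _ [p2 [s2 a2 i2 [q2 e2]]] ltL.
exists (rcons (p1 ++ p2) g); split.
- by rewrite size_rcons size_cat; lia.
- rewrite all_rcons all_cat a1 a2 !andbT.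
  by move: a1; rewrite e1 all_rcons /= => /andP[]; lia.
- have dcat := inferred_cat i1 i2.
  move=> i; rewrite size_rcons ltnS leq_eqVlt => /orP[/eqP->|lti]; last first.
    have [ax|hf|[a [b [la lb e]]]] := dcat _ lti.
    + by apply: Or31; rewrite nth_rcons lti.
    + by apply: Or32; rewrite nth_rcons lti.
    + apply: Or33; exists a, b; split=> //.
      by rewrite !nth_rcons lti (ltn_trans la lti) (ltn_trans lb lti).
  (* The premises of the last line are the final lines of the two blocks. *)
  apply: Or33; exists (size p1 + size q2), (size q1).
  have nth1 : nth Top p1 (size q1) = Imp f g by rewrite e1 nth_rcons ltnn eqxx.
  have nth2 : nth Top p2 (size q2) = f by rewrite e2 nth_rcons ltnn eqxx.
  have lt1 : size q1 < size p1 by rewrite e1 size_rcons.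
  have lt2 : size q2 < size p2 by rewrite e2 size_rcons.
  rewrite size_cat; split; [lia|lia|].
  rewrite !nth_rcons !size_cat ltnn eqxx ltn_add2l lt2 (ltn_addr _ lt1).
  by rewrite !nth_cat lt1 ltnNge leq_addr /= addKn nth1 nth2.
- by exists (p1 ++ p2).
Qed.

Lemma bounded_derivation M L f : bounded M L f ->
  exists p, EF_derivation H p f /\ derivation_size p <= L * M.
Proof.
case/bounded_lines=> p [sp ap ip [p' ep]]; exists p; split.
  split; [by rewrite ep size_rcons|by rewrite ep last_rcons|move=> i lti].
  have [ax|hf|[a [b [la lb e]]]] := ip _ lti.
  - exact: EF_axiom.
  - exact: EF_hyp.
  - by apply: (@EF_mp _ _ _ a b); rewrite ?size_takel ?nth_take // ltnW.
apply: (@leq_trans (size p * M)); last by rewrite leq_mul2r sp orbT.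
rewrite /derivation_size; elim: p ap {sp ip ep} => //= g p IHp /andP[sg /IHp].
by rewrite mulSn; lia.
Qed.

End Bounded.

Lemma fsize_gt0 (V : Type) (f : form V) : 0 < fsize f.
Proof. by case: f. Qed.

Lemma fsize_subst (V W : Type) (s : V -> form W) M f :
  0 < M -> (forall p, fsize (s p) <= M) -> fsize (subst s f) <= fsize f * M.
Proof.
move=> M0 sM; elim: f => [p|||f IHf|f IHf g IHg|f IHf g IHg] /=;
  rewrite ?mul1n // mulSn ?mulnDl; lia.
Qed.

Lemma subst_axiom (s : nat -> form nat) f : frege_axiom f -> frege_axiom (subst s f).
Proof. by case=> *; constructor. Qed.

(* A fixed proof of a tautology is instantiated line by line, so that the number
   of lines does not depend on the instance. *)
Lemma tautology_bounded f : tautology f -> exists c,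
  forall H (s : nat -> form nat) M, 0 < M ->
  (forall p, fsize (s p) <= M) -> bounded H (c * M) c (subst s f).
Proof.
move=> /(completeness (fun=> False)); elim=> {f} // [f ax|f g _ [c1 IH1] _ [c2 IH2]].
  exists (fsize f) => H s M M0 sM; apply: bounded_axiom.
  - exact: subst_axiom.
  - exact: fsize_gt0.
  - exact: fsize_subst.
exists (c1 + c2).+1 => H s M M0 sM.
apply: (@bounded_mp _ _ _ c1 c2 (subst s f)) => //.
- by apply: bounded_weaken (IH1 H s M M0 sM) => //; rewrite leq_mul2r; lia.
- by apply: bounded_weaken (IH2 H s M M0 sM) => //; rewrite leq_mul2r; lia.
Qed.

Lemma schemas_bounded (fs : seq (form nat)) :
  (forall i, i < size fs -> tautology (nth Top fs i)) ->
  exists c, forall H gs M i, i < size fs -> 0 < M ->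
    all (fun g => fsize g <= M) gs ->
    bounded H (c * M) c (subst (nth Top gs) (nth Top fs i)).
Proof.
elim: fs => [|f fs IHfs] taut; first by exists 0 => H gs M [].
have [c1 b1] := tautology_bounded (taut 0 isT).
have [c2 b2] := IHfs (fun i => taut i.+1).
exists (c1 + c2) => H gs M i lti M0 gsM.
have sM p : fsize (nth Top gs p) <= M.
  (* Variables beyond the list [gs] become [Top], of size 1. *)
  have [ltp|gep] := ltnP p (size gs); last by rewrite nth_default.
  exact: (all_nthP Top gsM).
case: i lti => [|i] lti /=.
- by apply: bounded_weaken (b1 H _ M M0 sM); rewrite ?leq_mul2r; lia.
- by apply: bounded_weaken (b2 H gs M i lti M0 gsM); rewrite ?leq_mul2r; lia.
Qed.

(** * Constant propagation *)

Section Simplification.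
Implicit Types f g : form nat.

Definition simp_neg f :=
  match f with Top => Bot | Bot => Top | _ => Neg f end.

Definition simp_and f g :=
  match f, g with
  | Top, _ => g
  | Bot, _ => Bot
  | _, Top => f
  | _, Bot => Bot
  | _, _ => And f g
  end.

Definition simp_or f g :=
  match f, g with
  | Top, _ => Top
  | Bot, _ => g
  | _, Top => Top
  | _, Bot => f
  | _, _ => Or f g
  end.

Fixpoint simp f : form nat :=
  match f with
  | Neg g => simp_neg (simp g)
  | And g h => simp_and (simp g) (simp h)
  | Or g h => simp_or (simp g) (simp h)
  | _ => f
  end.

Lemma fsize_simp f : fsize (simp f) <= fsize f.
Proof.
elim: f => //= [f IHf|f IHf g IHg|f IHf g IHg].
- by case: (simp f) IHf => //=; lia.
- by case: (simp f) IHf; case: (simp g) IHg => //=; lia.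
- by case: (simp f) IHf; case: (simp g) IHg => //=; lia.
Qed.

Lemma simp_or_bot f : simp_or f Bot = f.
Proof. by case: f. Qed.

(** The cases here, and those for disjunction below, come in the order of the corresponding entries
    of [simp_schemas]. *)
Lemma simp_and_cases f g :
  f = Top /\ simp_and f g = g \/ f = Bot /\ simp_and f g = Bot \/
  g = Top /\ simp_and f g = f \/ g = Bot /\ simp_and f g = Bot \/
  simp_and f g = And f g.
Proof. by case: f => *; case: g => *; tauto. Qed.

Lemma simp_or_cases f g :
  f = Top /\ simp_or f g = Top \/ f = Bot /\ simp_or f g = g \/
  g = Top /\ simp_or f g = Top \/ g = Bot /\ simp_or f g = f \/
  simp_or f g = Or f g.
Proof. by case: f => *; case: g => *; tauto. Qed.

Let p0 : form nat := Var 0.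
Let p1 : form nat := Var 1.
Let p2 : form nat := Var 2.
Let p3 : form nat := Var 3.

(** In these two patterns [p0] and [p2] stand for the immediate subformulas, and the primed
    arguments for their simplified forms. *)
Let neg_schema f' g := Imp (Equiv p0 f') (Equiv (Neg p0) g).
Let bin_schema (op : form nat -> form nat -> form nat) f' g' h :=
  Imp (Equiv p0 f') (Imp (Equiv p2 g') (Equiv (op p0 p2) h)).

(** Schema 0 serves variables and constants, schemas 1 and 2 compare formulas with a common normal
    form, and each later one justifies one rewriting rule. *)
Let simp_schemas : seq (form nat) :=
  [:: Equiv p0 p0;
      Imp (Equiv p0 p1) (Imp (Equiv p2 p1) (Equiv p0 p2));
      Imp (Equiv p0 p1) (Imp (Equiv (Neg (Neg p2)) p1) (Imp p0 p2));
      neg_schema Top Bot; neg_schema Bot Top; neg_schema p1 (Neg p1);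
      bin_schema (@And nat) Top p3 p3; bin_schema (@And nat) Bot p3 Bot;
      bin_schema (@And nat) p1 Top p1; bin_schema (@And nat) p1 Bot Bot;
      bin_schema (@And nat) p1 p3 (And p1 p3);
      bin_schema (@Or nat) Top p3 Top; bin_schema (@Or nat) Bot p3 p3;
      bin_schema (@Or nat) p1 Top Top; bin_schema (@Or nat) p1 Bot p1;
      bin_schema (@Or nat) p1 p3 (Or p1 p3)].

Let simp_schemas_tautology i : i < size simp_schemas ->
  tautology (nth Top simp_schemas i).
Proof.
by do 16! [case: i => [|i];
  first by move=> _ v /=; move: (v 0) (v 1) (v 2) (v 3); do 4!case].
Qed.

(** One schema instance per node of the formula suffices, so the number of lines is linear in its
    size, while the line size depends only on [M]. *)
Lemma simp_bounded : exists2 c, 0 < c & forall H M,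
  [/\ forall f, fsize f <= M -> bounded H (c * M) (c * fsize f) (Equiv f (simp f)),
      forall f g h, fsize f <= M -> fsize g <= M -> fsize h <= M ->
        bounded H (c * M) c (Imp (Equiv f h) (Imp (Equiv g h) (Equiv f g))) &
      forall f g h, fsize f <= M -> fsize g <= M -> fsize h <= M ->
        bounded H (c * M) c
          (Imp (Equiv f h) (Imp (Equiv (Neg (Neg g)) h) (Imp f g)))].
Proof.
have [c b] := schemas_bounded simp_schemas_tautology.
(* A node costs the [c] lines of its schema and at most two applications of modus ponens. *)
exists c.+2 => // H M; split; first last.
- move=> f g h sf sg sh; have M0 : 0 < M := leq_trans (fsize_gt0 f) sf.
  apply: bounded_weaken (b H [:: f; h; g] M 2 isT M0 _).
  - by rewrite leq_mul2r; lia.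
  - by lia.
  - by rewrite /= sf sh sg.
- move=> f g h sf sg sh; have M0 : 0 < M := leq_trans (fsize_gt0 f) sf.
  apply: bounded_weaken (b H [:: f; h; g] M 1 isT M0 _).
  - by rewrite leq_mul2r; lia.
  - by lia.
  - by rewrite /= sf sh sg.
have schema gs i : i < size simp_schemas -> 0 < M ->
    all (fun g => fsize g <= M) gs ->
    bounded H (c.+2 * M) c (subst (nth Top gs) (nth Top simp_schemas i)).
  move=> lti M0 gsM; apply: bounded_weaken (b H gs M i lti M0 gsM) => //.
  by rewrite leq_mul2r; lia.
have mp2 L1 L2 f1 f2 g : bounded H (c.+2 * M) c (Imp f1 (Imp f2 g)) ->
    bounded H (c.+2 * M) L1 f1 -> bounded H (c.+2 * M) L2 f2 ->
    bounded H (c.+2 * M) (c.+2 + L1 + L2) g.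
  move=> d d1 d2; apply: bounded_mp d2 _; first exact: (bounded_mp d d1 (leqnn _)).
  by lia.
elim=> [p|||f IHf|f IHf g IHg|f IHf g IHg] /= sM.
- by apply: bounded_weaken (schema [:: Var p] 0 isT _ _) => //=; lia.
- by apply: bounded_weaken (schema [:: Top] 0 isT _ _) => //=; lia.
- by apply: bounded_weaken (schema [:: Bot] 0 isT _ _) => //=; lia.
- have sf : fsize f <= M by lia.
  have ss := leq_trans (fsize_simp f) sf.
  have M0 : 0 < M := leq_trans (fsize_gt0 f) sf.
  apply: (bounded_mp (L1 := c) _ (IHf sf)); last by lia.
  have [e|[e|e]] : simp f = Top \/ simp f = Bot \/ simp_neg (simp f) = Neg (simp f).
    by case: (simp f); auto.
  + rewrite e /=; apply: (schema [:: f] 3) => //=; lia.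
  + rewrite e /=; apply: (schema [:: f] 4) => //=; lia.
  + rewrite e; apply: (schema [:: f; simp f] 5) => //=; lia.
- have sf : fsize f <= M by lia.
  have sg : fsize g <= M by lia.
  have ss := leq_trans (fsize_simp f) sf.
  have st := leq_trans (fsize_simp g) sg.
  have M0 : 0 < M := leq_trans (fsize_gt0 f) sf.
  apply: (@bounded_weaken _ (c.+2 * M) (c.+2 + c.+2 * fsize f + c.+2 * fsize g)) => //.
    by lia.
  apply: (mp2 _ _ _ _ _ _ (IHf sf) (IHg sg)).
  have [[e ->]|[[e ->]|[[e ->]|[[e ->]|->]]]] := simp_and_cases (simp f) (simp g).
  + by rewrite e; apply: (schema [:: f; Top; g; simp g] 6) => //=; lia.
  + by rewrite e; apply: (schema [:: f; Bot; g; simp g] 7) => //=; lia.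
  + by rewrite e; apply: (schema [:: f; simp f; g] 8) => //=; lia.
  + by rewrite e; apply: (schema [:: f; simp f; g] 9) => //=; lia.
  + by apply: (schema [:: f; simp f; g; simp g] 10) => //=; lia.
- have sf : fsize f <= M by lia.
  have sg : fsize g <= M by lia.
  have ss := leq_trans (fsize_simp f) sf.
  have st := leq_trans (fsize_simp g) sg.
  have M0 : 0 < M := leq_trans (fsize_gt0 f) sf.
  apply: (@bounded_weaken _ (c.+2 * M) (c.+2 + c.+2 * fsize f + c.+2 * fsize g)) => //.
    by lia.
  apply: (mp2 _ _ _ _ _ _ (IHf sf) (IHg sg)).
  have [[e ->]|[[e ->]|[[e ->]|[[e ->]|->]]]] := simp_or_cases (simp f) (simp g).
  + by rewrite e; apply: (schema [:: f; Top; g; simp g] 11) => //=; lia.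
  + by rewrite e; apply: (schema [:: f; Bot; g; simp g] 12) => //=; lia.
  + by rewrite e; apply: (schema [:: f; simp f; g] 13) => //=; lia.
  + by rewrite e; apply: (schema [:: f; simp f; g] 14) => //=; lia.
  + by apply: (schema [:: f; simp f; g; simp g] 15) => //=; lia.
Qed.

End Simplification.

(** A [Prop]-valued [all], needed for equations between formulas, which carry no boolean
    equality. *)
Fixpoint All (T : Type) (P : T -> Prop) (s : seq T) : Prop :=
  if s is x :: s' then P x /\ All P s' else True.

Section AllTheory.
Variables (T : Type) (P : T -> Prop).

Lemma All_cat s1 s2 : All P s1 -> All P s2 -> All P (s1 ++ s2).
Proof. by elim: s1 => //= x s1 IHs [Px Ps1] Ps2; split; last exact: IHs. Qed.

Lemma All_map (I : eqType) (F : I -> T) r :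
  (forall i, i \in r -> P (F i)) -> All P [seq F i | i <- r].
Proof.
elim: r => //= i r IHr PF; split; first by apply: PF; rewrite inE eqxx.
by apply: IHr => j jr; apply: PF; rewrite inE jr orbT.
Qed.

Lemma All_flatten (I : eqType) (F : I -> seq T) r :
  (forall i, i \in r -> All P (F i)) -> All P (flatten [seq F i | i <- r]).
Proof.
elim: r => //= i r IHr PF; apply: All_cat; first by apply: PF; rewrite inE eqxx.
by apply: IHr => j jr; apply: PF; rewrite inE jr orbT.
Qed.

End AllTheory.

(** * Discharging definitions *)

(** The shape of [with_defs] after a substitution, when the defined variables have become arbitrary
    formulas. *)
Definition with_eqs (ds : seq (form nat * form nat)) (f : form nat) : form nat :=
  foldr (fun d acc => Imp (Equiv d.1 d.2) acc) f ds.

Lemma subst_with_defs (V : Type) (s : V -> form nat) ds f :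
  subst s (with_defs ds f) =
  with_eqs [seq (s d.1, subst s d.2) | d <- ds] (subst s f).
Proof. by elim: ds => //= d ds <-. Qed.

(** Two sides with the same normal form are provably equivalent, so modus ponens removes the
    premises one by one; [f] then yields [g] through their common normal form. There are at most [Z]
    premises, each costing linearly many lines in [Z], hence the bound [Z * Z]. *)
Lemma bounded_with_eqs : exists c, forall (H : form nat -> Prop) ds f g Z,
  H (with_eqs ds f) -> All (fun d => simp d.1 = simp d.2) ds ->
  simp f = simp (Neg (Neg g)) -> fsize (with_eqs ds f) <= Z -> fsize g <= Z ->
  bounded H (c * Z) (c * (Z * Z)) g.
Proof.
have [c c0 simpb] := simp_bounded; exists (20 * c) => H ds f g Z Hdf sds sfg leZ leg.
have Z0 : 0 < Z := leq_trans (fsize_gt0 _) leg.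
(* The factor 3 makes room for [Neg (Neg g)], which may exceed [Z] by two symbols. *)
have [simpB trans equivE] := simpb H (3 * Z).
have leMM : Z <= Z * Z by rewrite leq_pmulr.
set M := c * (3 * Z) in simpB trans equivE.
have ZM : Z <= M by rewrite /M; nia.
have sf : fsize f <= fsize (with_eqs ds f).
  by elim: ds {Hdf sds leZ} => //= d ds; lia.
have sz_ds : size ds <= fsize (with_eqs ds f).
  by elim: ds {Hdf sds leZ sf} => //= d ds; lia.
have mp3 L1 L2 f1 f2 h : bounded H M c (Imp f1 (Imp f2 h)) ->
    bounded H M L1 f1 -> bounded H M L2 f2 -> bounded H M (c + L1 + L2 + 2) h.
  move=> d d1 d2; apply: bounded_mp d2 _; first exact: (bounded_mp d d1 (leqnn _)).
  by lia.
have discharge L : bounded H M L (with_eqs ds f) ->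
    bounded H M (L + size ds * (8 * c * Z)) f.
  clearbody M; elim: ds sds leZ L {Hdf sf sz_ds} => [|[u v] ds IHds] /=.
    by move=> _ _ L; rewrite addn0.
  move=> [suv sds] leZ L b.
  have su : fsize u <= 3 * Z by lia.
  have sv : fsize v <= 3 * Z by lia.
  have sw : fsize (simp u) <= 3 * Z := leq_trans (fsize_simp u) su.
  have bu := simpB u su; have bv := simpB v sv; rewrite -suv in bv.
  have buv := mp3 _ _ _ _ _ (trans u v (simp u) su sv sw) bu bv.
  have bd := bounded_mp b buv (leqnn _).
  have leZ2 : fsize (with_eqs ds f) <= Z by lia.
  apply: bounded_weaken (IHds sds leZ2 _ bd) => //.
  have le1 : fsize u <= Z by lia.
  have le2 : fsize v <= Z by lia.
  by nia.
have sf3 : fsize f <= 3 * Z by lia.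
have sg3 : fsize (Neg (Neg g)) <= 3 * Z by rewrite /=; lia.
have sg : fsize g <= 3 * Z by move: sg3 => /=; lia.
have ss := leq_trans (fsize_simp f) sf3.
have bf := simpB f sf3; have bg := simpB _ sg3; rewrite -sfg in bg.
have bfg := mp3 _ _ _ _ _ (equivE f g (simp f) sf3 sg ss) bf bg.
have bI : bounded H M 1 (with_eqs ds f) by apply: bounded_hyp => //; lia.
apply: bounded_weaken (bounded_mp bfg (discharge _ bI) (leqnn _)).
  by rewrite /M; lia.
have le1 : c * fsize f <= c * (Z * Z) by rewrite leq_mul2l; lia.
have le2 : c * fsize (Neg (Neg g)) <= 3 * (c * (Z * Z)) by move: sg3 => /=; nia.
have le3 : size ds * (8 * c * Z) <= 8 * (c * (Z * Z)) by nia.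
have le4 : c <= c * (Z * Z) by nia.
by lia.
Qed.

(** * Running the parser on well-formed strings *)

Definition token_bit (k : token) (j : nat) : bool :=
  let: (a, b, c) := token_bits k in nth false [:: a; b; c] j.

(** A total version of one step of [parse]: missing cells are read as [Bot], whereas [parse] fails.
    The two agree as long as there is no underflow. *)
Definition parse_step (s : nat * seq (form nat)) (k : token) :
    nat * seq (form nat) :=
  let: (i, st) := s in
  match k with
  | TPad => (i, st)
  | TTick => (i.+1, st)
  | TVar => (0, Var i :: st)
  | TTop => (0, Top :: st)
  | TBot => (0, Bot :: st)
  | TNeg => (0, Neg (nth Bot st 0) :: drop 1 st)
  | TAnd => (0, And (nth Bot st 1) (nth Bot st 0) :: drop 2 st)
  | TOr => (0, Or (nth Bot st 1) (nth Bot st 0) :: drop 2 st)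
  end.

Definition arity (k : token) : nat :=
  match k with TNeg => 1 | TAnd | TOr => 2 | _ => 0 end.

Definition parse_state (ts : seq token) (t : nat) : nat * seq (form nat) :=
  foldl parse_step (0, [::]) (take t ts).

Definition no_underflow (ts : seq token) : Prop :=
  forall t, t < size ts -> arity (nth TPad ts t) <= size (parse_state ts t).2.

Lemma parse_stateS ts t : t < size ts ->
  parse_state ts t.+1 = parse_step (parse_state ts t) (nth TPad ts t).
Proof.
by move=> lt_t; rewrite /parse_state (take_nth TPad) // foldl_rcons.
Qed.

(** Before the end of the string the counter therefore stays in the range covered by the variables
    [SIdx]. *)
Lemma parse_state_idx ts t : t <= size ts -> (parse_state ts t).1 <= t.
Proof.
elim: t => [|t IHt] le_t; first by rewrite /parse_state take0.
rewrite parse_stateS //; have := IHt (ltnW le_t).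
by case: (parse_state ts t) => i st; case: (nth TPad ts t) => /=; lia.
Qed.

(** A token adds at most one symbol to the stack as a whole. Underflow would break this, since the
    default [Bot] would add a symbol of its own. *)
Lemma sumn_parse_state ts t : no_underflow ts -> t <= size ts ->
  sumn [seq fsize f | f <- (parse_state ts t).2] <= t.
Proof.
move=> ok; elim: t => [|t IHt] le_t; first by rewrite /parse_state take0.
rewrite parse_stateS //; have := IHt (ltnW le_t).
have := ok _ le_t; case: (parse_state ts t) => i st.
case: (nth TPad ts t) => /=; try lia.
- by case: st => [|f st] /=; rewrite ?drop0; lia.
- by case: st => [|f [|g st]] /=; rewrite ?drop0; lia.
- by case: st => [|f [|g st]] /=; rewrite ?drop0; lia.
Qed.

Lemma size_parse_state ts t : no_underflow ts -> t <= size ts ->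
  size (parse_state ts t).2 <= t.
Proof.
move=> ok /(sumn_parse_state ok); apply: leq_trans.
elim: (parse_state ts t).2 => //= f st IHst.
by have := fsize_gt0 f; lia.
Qed.

(** Once the string is fixed, the control data of the parser are constants. Only the cell values
    depend on the assignment, which enters as the formulas [e]. *)
Definition sat_assign (ts : seq token) (e : nat -> form nat) (a : satvar) : form nat :=
  match a with
  | SIdx t i => Const nat (i == (parse_state ts t).1)
  | SOk _ => Top
  | SOcc t j => Const nat (j < size (parse_state ts t).2)
  | SVal t j => nth Bot [seq subst e f | f <- (parse_state ts t).2] j
  end.

Lemma fsize_sat_assign ts e a : no_underflow ts -> (forall i, fsize (e i) <= 1) ->
  fsize (sat_assign ts e a) <= (size ts).+1.
Proof.
move=> ok e1; have szC b : fsize (Const nat b) <= (size ts).+1 by case: b.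
case: a => [t i|t|t j|t j]; [exact: szC|by []|exact: szC|rewrite /=].
(* Past the end of the string the state no longer changes, so [t] can be capped at [size ts]. *)
have le_t : minn t (size ts) <= size ts by rewrite geq_minr.
have -> : parse_state ts t = parse_state ts (minn t (size ts)).
  rewrite /parse_state; case: (leqP t (size ts)) => // lt_t.
  by rewrite take_size take_oversize // ltnW.
have := leq_trans (sumn_parse_state ok le_t) le_t.
elim: (parse_state _ _).2 j => [|f st IHst] [|j] //= le_st.
  by have := fsize_subst f (ltn0Sn 0) e1; lia.
by apply: IHst; lia.
Qed.

Lemma subst_const (V W : Type) (s : V -> form W) b : subst s (Const V b) = Const W b.
Proof. by case: b. Qed.

Lemma simp_const b : simp (Const nat b) = Const nat b.
Proof. by case: b. Qed.

(** All disjuncts but one propagate to [Bot] and vanish. This evaluates the selections by index in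
    [alpha]: the variable named by the tick counter and the wires of [C]. *)
Lemma simp_subst_bigOr_pick (V : Type) (s : V -> form nat) (I : eqType)
    (F : I -> form V) r i0 : uniq r -> i0 \in r ->
  (forall i, i \in r -> i != i0 -> simp (subst s (F i)) = Bot) ->
  simp (subst s (bigOr [seq F i | i <- r])) = simp (subst s (F i0)).
Proof.
elim: r => //= i r IHr /andP[ir ur]; rewrite inE.
case: (eqVneq i0 i) => [-> _|ne /= i0r] FB.
  suff -> : simp (subst s (bigOr [seq F j | j <- r])) = Bot by rewrite simp_or_bot.
  elim: r ir {IHr ur} FB => //= j r IHr; rewrite inE negb_or => /andP[ne ir] FB.
  rewrite FB ?inE ?eqxx ?orbT 1?eq_sym //=; apply: IHr => // k.
  rewrite inE => /orP[/eqP->|kr]; first by rewrite eqxx.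
  by apply: FB; rewrite !inE kr !orbT.
rewrite FB ?inE ?eqxx 1?eq_sym //=; apply: IHr => // j jr.
by apply: FB; rewrite inE jr orbT.
Qed.

Section SatSound.
Variables (V : Type) (n : nat) (x y : nat -> form V) (aux : satvar -> V).
Variables (s : V -> form nat) (ts : seq token) (e : nat -> form nat).
Hypothesis size_ts : size ts = n %/ 3.
Hypothesis ts_ok : no_underflow ts.
Hypothesis x_const : forall i,
  subst s (x i) = Const nat (token_bit (nth TPad ts (i %/ 3)) (i %% 3)).
Hypothesis y_subst : forall i, subst s (y i) = e i.
Hypothesis aux_subst : forall a, s (aux a) = sat_assign ts e a.

Let T := n %/ 3.

Let tick_idxE t i : t < T -> subst s (tick_idx n aux t i) =
  Const nat (i == (parse_state ts t).1).
Proof.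
move=> lt_t; rewrite /tick_idx -/T; case: ifP => [_|ge_i] /=; first by rewrite aux_subst.
(* Outside the range the formula is [Bot], which is right because the counter is at most [t < T]. *)
have := @parse_state_idx ts t; rewrite size_ts -/T => /(_ (ltnW lt_t)) le_idx.
by have -> : (i == (parse_state ts t).1) = false by lia.
Qed.

Let cell_occE t j : t <= T -> subst s (cell_occ n aux t j) =
  Const nat (j < size (parse_state ts t).2).
Proof.
move=> le_t; rewrite /cell_occ -/T; case: ifP => [_|ge_j] /=; first by rewrite aux_subst.
have := @size_parse_state ts t ts_ok; rewrite size_ts -/T => /(_ le_t) le_sz.
by have -> : (j < size (parse_state ts t).2) = false by lia.
Qed.

Let cell_valE t j : t <= T -> subst s (cell_val n aux t j) =
  nth Bot [seq subst e f | f <- (parse_state ts t).2] j.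
Proof.
move=> le_t; rewrite /cell_val -/T; case: ifP => [_|ge_j] /=; first by rewrite aux_subst.
have := @size_parse_state ts t ts_ok; rewrite size_ts -/T => /(_ le_t) le_sz.
by rewrite nth_default // size_map; lia.
Qed.

(** The bits of [x] are constants, so of the eight guards only that of the actual token survives. *)
Let token_caseE t F : simp (subst s (token_case x t F)) =
  simp (subst s (F (nth TPad ts t))).
Proof.
rewrite /token_case /is_token /=.
have d0 : (3 * t) %/ 3 = t by lia.
have d1 : (3 * t).+1 %/ 3 = t by lia.
have d2 : (3 * t).+2 %/ 3 = t by lia.
have m0 : (3 * t) %% 3 = 0 by lia.
have m1 : (3 * t).+1 %% 3 = 1 by lia.
have m2 : (3 * t).+2 %% 3 = 2 by lia.
rewrite !x_const d0 d1 d2 m0 m1 m2.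
by case: (nth TPad ts t) => /=; rewrite ?simp_or_bot.
Qed.

Let read_varE t : t < T ->
  simp (subst s (read_var n y aux t)) = simp (e (parse_state ts t).1).
Proof.
move=> lt_t; rewrite /read_var -/T.
have := @parse_state_idx ts t; rewrite size_ts -/T => /(_ (ltnW lt_t)) le_idx.
rewrite (@simp_subst_bigOr_pick _ _ _ _ _ (parse_state ts t).1) /=.
- by rewrite tick_idxE // eqxx y_subst.
- exact: iota_uniq.
- by rewrite mem_iota; lia.
- by move=> i _ ne; rewrite tick_idxE // (negPf ne).
Qed.

Local Arguments token_case : simpl never.

Let sound (d : V * form V) := simp (s d.1) = simp (subst s d.2).

(** The case distinction over tokens collapses to the clause of the token at [t], and this clause
    describes what [parse_step] does to the counter or to a cell. *)
Lemma sat_defs_sound : All sound (sat_defs n x y aux).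
Proof.
apply: All_cat.
  split; first by rewrite /sound aux_subst.
  rewrite /sound; apply: All_cat; first apply: All_map => i _ /=.
    by rewrite aux_subst /= /parse_state take0 subst_const.
  apply: All_cat; apply: All_map => j _ /=; rewrite aux_subst /= /parse_state take0 //=.
  by rewrite nth_nil.
apply: All_flatten => t; rewrite mem_iota add0n -/T /= => lt_t.
have le_t := ltnW lt_t.
have lt_ts : t < size ts by rewrite size_ts.
have okt := ts_ok lt_ts.
have stS := parse_stateS lt_ts.
split; last apply: All_cat; last apply: All_cat.
- rewrite /sound [(_, _).1]/= [(_, _).2]/=.
  have -> f g : simp (subst s (And f g)) =
    simp_and (simp (subst s f)) (simp (subst s g)) by [].
  rewrite token_caseE /= !aux_subst /=.
  by case: (nth TPad ts t) okt => //= okt; rewrite cell_occE // okt.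
- apply: All_map => i _; rewrite /sound [(_, _).1]/= [(_, _).2]/= token_caseE.
  rewrite !aux_subst /= stS.
  case: (parse_state ts t) (@tick_idxE t) => i0 st /= idxE.
  case: (nth TPad ts t) => /=; rewrite ?subst_const ?idxE //.
  by case: i => [|i] //=; rewrite idxE.
- apply: All_map => j _; rewrite /sound [(_, _).1]/= [(_, _).2]/= token_caseE.
  rewrite !aux_subst /= stS.
  case: (parse_state ts t) okt (fun j => @cell_occE t j le_t) => i0 st /= okt occE.
  case: (nth TPad ts t) okt => /= okt; rewrite ?subst_const ?occE //;
    first [by case: j => [|j] //=; rewrite occE
          |by case: st okt occE => [|f [|g st]] //= _ _; rewrite ?drop0].
- apply: All_map => j _; rewrite /sound [(_, _).1]/= [(_, _).2]/= token_caseE.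
  rewrite !aux_subst /= stS.
  have := read_varE lt_t.
  case: (parse_state ts t) okt (fun j => @cell_valE t j le_t) => i0 st /= okt valE varE.
  case: (nth TPad ts t) okt => /= okt; rewrite ?subst_const ?valE //;
    try by case: j => [|j] //=; rewrite ?valE ?varE.
  + by case: st okt valE => [|f st] // _ valE; case: j => [|j] /=; rewrite valE /= ?drop0.
  + case: st okt valE => [|f [|g st]] // _ valE.
    by case: j => [|j] /=; rewrite !valE /= ?drop0.
  + case: st okt valE => [|f [|g st]] // _ valE.
    by case: j => [|j] /=; rewrite !valE /= ?drop0.
Qed.

Lemma sat_out_simp i f : parse_state ts T = (i, [:: f]) ->
  simp (subst s (sat_out n aux)) = simp (subst e f).
Proof.
move=> eT; rewrite /sat_out -/T /= aux_subst !cell_occE // cell_valE // eT /=.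
by [].
Qed.

End SatSound.

(** * Encoding formulas as strings *)

Fixpoint encode (f : form nat) : seq token :=
  match f with
  | Var i => rcons (nseq i TTick) TVar
  | Top => [:: TTop]
  | Bot => [:: TBot]
  | Neg g => rcons (encode g) TNeg
  | And g h => encode g ++ rcons (encode h) TAnd
  | Or g h => encode g ++ rcons (encode h) TOr
  end.

(** Absence of underflow from an arbitrary starting state, a form that can be followed through
    concatenations. *)
Fixpoint safe (s : nat * seq (form nat)) (ts : seq token) : bool :=
  if ts is k :: ts' then (arity k <= size s.2) && safe (parse_step s k) ts' else true.

Lemma safe_no_underflow ts : safe (0, [::]) ts -> no_underflow ts.
Proof.
rewrite /no_underflow /parse_state; move: (0, [::]).
elim: ts => //= k ts IHts s /andP[ok sf] [|t] //= lt_t; exact: IHts.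
Qed.

Lemma foldl_ticks i st m ts :
  foldl parse_step (i, st) (nseq m TTick ++ ts) = foldl parse_step (i + m, st) ts.
Proof. by elim: m i => [|m IHm] i /=; rewrite ?addn0 // IHm addSnnS. Qed.

Lemma safe_ticks i st m ts : safe (i, st) (nseq m TTick ++ ts) = safe (i + m, st) ts.
Proof. by elim: m i => [|m IHm] i /=; rewrite ?addn0 // IHm addSnnS. Qed.

(** Stack and remaining tokens are arbitrary because operands are read on top of earlier ones. The
    counter can be 0 throughout, since every code ends with a token that resets it. *)
Lemma foldl_encode f st ts :
  foldl parse_step (0, st) (encode f ++ ts) = foldl parse_step (0, f :: st) ts.
Proof.
elim: f st ts => [i|||f IHf|f IHf g IHg|f IHf g IHg] st ts //=.
- by rewrite cat_rcons foldl_ticks.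
- by rewrite cat_rcons IHf /= drop0.
- by rewrite -catA cat_rcons IHf IHg /= drop0.
- by rewrite -catA cat_rcons IHf IHg /= drop0.
Qed.

Lemma safe_encode f st ts : safe (0, st) (encode f ++ ts) = safe (0, f :: st) ts.
Proof.
elim: f st ts => [i|||f IHf|f IHf g IHg|f IHf g IHg] st ts //=.
- by rewrite cat_rcons safe_ticks.
- by rewrite cat_rcons IHf /= drop0.
- by rewrite -catA cat_rcons IHf IHg /= drop0.
- by rewrite -catA cat_rcons IHf IHg /= drop0.
Qed.

Definition padded_encode (T : nat) (f : form nat) : seq token :=
  encode f ++ nseq (T - size (encode f)) TPad.

Lemma padded_encode_ok T f : size (encode f) <= T ->
  [/\ size (padded_encode T f) = T, no_underflow (padded_encode T f) &
      parse_state (padded_encode T f) T = (0, [:: f])].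
Proof.
move=> le_T; have szT : size (padded_encode T f) = T.
  by rewrite size_cat size_nseq subnKC.
split=> //.
  apply: safe_no_underflow; rewrite safe_encode.
  by elim: (T - _).
rewrite /parse_state take_oversize ?szT // foldl_encode.
by elim: (T - _).
Qed.

Fixpoint vars (f : form nat) : seq nat :=
  match f with
  | Var p => [:: p]
  | Top | Bot => [::]
  | Neg g => vars g
  | And g h | Or g h => vars g ++ vars h
  end.

(* Variable names are unbounded, hence are replaced by positions in a list of
   variables before encoding. *)
Definition reindex (vs : seq nat) (f : form nat) : form nat :=
  subst (fun p => Var (index p vs)) f.

Lemma size_vars f : size (vars f) <= fsize f.
Proof. by elim: f => //= [f|f IHf g|f IHf g]; rewrite ?size_cat; lia. Qed.

Lemma reindexK vs f : {subset vars f <= vs} ->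
  subst (fun i => Var (nth 0 vs i)) (reindex vs f) = f.
Proof.
elim: f => //= [p|f IHf|f IHf g IHg|f IHf g IHg] sub.
- by rewrite nth_index // sub // inE.
- by rewrite IHf.
- by rewrite IHf ?IHg // => q qv; apply: sub; rewrite mem_cat qv ?orbT.
- by rewrite IHf ?IHg // => q qv; apply: sub; rewrite mem_cat qv ?orbT.
Qed.

Lemma eval_reindex vs f v : eval v (reindex vs f) = eval (fun p => v (index p vs)) f.
Proof. by elim: f => //= [f ->|f -> g ->|f -> g ->]. Qed.

(** A position in [vs] is written in unary, so each symbol of [f] costs at most [size vs] ticks and
    one further token. *)
Lemma size_encode_reindex vs f :
  size (encode (reindex vs f)) <= fsize f * (size vs).+1.
Proof.
rewrite /reindex; elim: f => //= [p|f IHf|f IHf g IHg|f IHf g IHg].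
- by rewrite size_rcons size_nseq mul1n ltnS index_size.
- by rewrite size_rcons mulSn; lia.
- by rewrite size_cat size_rcons mulSn mulnDl; lia.
- by rewrite size_cat size_rcons mulSn mulnDl; lia.
Qed.

Lemma simp_subst_const (b : nat -> bool) f :
  simp (subst (fun i => Const nat (b i)) f) = Const nat (eval b f).
Proof.
elim: f => //= [p|f ->|f -> g ->|f -> g ->]; first exact: simp_const.
- by case: (eval b f).
- by case: (eval b f); case: (eval b g).
- by case: (eval b f); case: (eval b g).
Qed.

(** * The instance of alpha *)

(** Wire values do not depend on the outputs, so the output list is left empty. *)
Definition wires (gs : seq gate) (x : seq bool) : seq bool :=
  wire_vals (Circuit gs [::]) x.

Lemma size_wires gs x : size (wires gs x) = size x + size gs.
Proof.
rewrite /wires /wire_vals /=; elim: gs x => [|a gs IHgs] x /=; first by rewrite addn0.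
by rewrite IHgs size_rcons addSnnS.
Qed.

(** Later gates only append values. This permits both padding a circuit and evaluating a gate in its
    prefix. *)
Lemma nth_wires_cat gs1 gs2 x i : i < size x + size gs1 ->
  nth false (wires (gs1 ++ gs2) x) i = nth false (wires gs1 x) i.
Proof.
have -> : wires (gs1 ++ gs2) x =
    foldl (fun vs a => rcons vs (gate_val vs a)) (wires gs1 x) gs2.
  by rewrite /wires /wire_vals foldl_cat.
rewrite -size_wires; elim: gs2 (wires gs1 x) => //= a gs2 IHgs vs lti.
by rewrite IHgs ?size_rcons ?nth_rcons ?lti // ltnW.
Qed.

Lemma nth_wires_input gs x i : i < size x -> nth false (wires gs x) i = nth false x i.
Proof. by move=> lti; rewrite (@nth_wires_cat [::] gs) //= addn0. Qed.

(** A well-formed gate reads only earlier wires, whose values in the prefix [take g gs] are already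
    the final ones. *)
Lemma nth_wires_gate gs x g : g < size gs ->
  gate_wf (size x + g) (nth (GNot 0) gs g) ->
  nth false (wires gs x) (size x + g) = gate_val (wires gs x) (nth (GNot 0) gs g).
Proof.
move=> ltg; set a := nth _ _ _ => wfa.
have szt : size (take g gs) = g by rewrite size_takel // ltnW.
have eqlt i : i < size x + g ->
    nth false (wires gs x) i = nth false (wires (take g gs) x) i.
  by move=> lti; rewrite -{1}(cat_take_drop g gs) nth_wires_cat ?szt.
have -> : nth false (wires gs x) (size x + g) = gate_val (wires (take g gs) x) a.
  rewrite -{1}(cat_take_drop g.+1 gs) nth_wires_cat ?size_takel ?ltn_add2l //.
  rewrite (take_nth (GNot 0)) // {1}/wires /wire_vals /= foldl_rcons.
  rewrite -/(wire_vals (Circuit (take g gs) [::]) x) -/(wires _ x) -/a.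
  by rewrite nth_rcons size_wires szt ltnn eqxx.
by case: a wfa => [i lti|i j /andP[lti ltj]|i j /andP[lti ltj]] /=; rewrite !eqlt.
Qed.

(** A negation gets its single input on both sides, because [C_valid] demands exactly one left and
    one right wire for every gate. *)
Definition gate_left (a : gate) : nat :=
  match a with GNot i => i | GAnd i _ | GOr i _ => i end.

Definition gate_right (a : gate) : nat :=
  match a with GNot i => i | GAnd _ j | GOr _ j => j end.

Section AlphaInstance.
Variables (n s : nat) (A : {set n.-tuple bool}) (B : circuit).
Variables (gs : seq gate) (o : nat) (ts : seq token) (vs : seq nat).

(** The bits after the last complete token fall on the default [TPad] and are false. *)
Definition input_bit (i : nat) : bool := token_bit (nth TPad ts (i %/ 3)) (i %% 3).

Definition input_string : seq bool := mkseq input_bit n.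

Definition B_output (i : nat) : bool :=
  (i < size (outs B)) && nth false (wires (gates B) input_string) (nth 0 (outs B) i).

Definition y_form (i : nat) : form nat := Var (nth 0 vs i).

Definition alpha_assign (a : avar) : form nat :=
  match a with
  | VX i => Const nat (input_bit i)
  | VY i => y_form i
  | VSatY b => sat_assign ts y_form b
  | VSatB b => sat_assign ts (fun i => Const nat (B_output i)) b
  | VB g => Const nat (nth false (wires (gates B) input_string) (n + g))
  | VCneg g => Const nat (if nth (GNot 0) gs g is GNot _ then true else false)
  | VCand g => Const nat (if nth (GNot 0) gs g is GAnd _ _ then true else false)
  | VCleft g w => Const nat (w == gate_left (nth (GNot 0) gs g))
  | VCright g w => Const nat (w == gate_right (nth (GNot 0) gs g))
  | VCout w => Const nat (w == o)
  | VCval z g => Const nat (nth false (wires gs z) (n + g))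
  end.

Let asg := alpha_assign.

Hypothesis size_ts : size ts = n %/ 3.
Hypothesis ts_ok : no_underflow ts.
Hypothesis wfB : circuit_wf n B.
Hypothesis size_gs : size gs = s.
Hypothesis wf_gs : forall g, g < s -> gate_wf (n + g) (nth (GNot 0) gs g).
Hypothesis lt_o : o < n + s.
Hypothesis gs_correct : forall z : n.-tuple bool, nth false (wires gs z) o = SATn z.

Let B_wireE w : subst asg (B_wire n w) =
  Const nat (nth false (wires (gates B) input_string) w).
Proof.
rewrite /B_wire; case: ltnP => [ltw|lew] /=; last by rewrite subnKC.
by rewrite nth_wires_input ?size_mkseq // nth_mkseq.
Qed.

Let fB_E i : subst asg (fB n B i) = Const nat (B_output i).
Proof. by rewrite /fB /B_output; case: ifP => //= _; rewrite B_wireE. Qed.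

Let C_wireE (z : n.-tuple bool) w : subst asg (C_wire n z w) =
  Const nat (nth false (wires gs z) w).
Proof.
rewrite /C_wire; case: ltnP => [ltw|lew] /=; last by rewrite subnKC.
by rewrite nth_wires_input ?size_tuple // subst_const.
Qed.

Let C_selectE (z : n.-tuple bool) m p l : l < m ->
  (forall w, asg (p w) = Const nat (w == l)) ->
  simp (subst asg (C_select n z m p)) = Const nat (nth false (wires gs z) l).
Proof.
move=> ltl pE; rewrite /C_select (@simp_subst_bigOr_pick _ _ _ _ _ l) /=.
- by rewrite pE eqxx C_wireE /= simp_const.
- exact: iota_uniq.
- by rewrite mem_iota.
- by move=> w _ /negPf ne; rewrite pE ne.
Qed.

Let sound (d : avar * form avar) := simp (asg d.1) = simp (subst asg d.2).

Let B_defs_sound : All sound (B_defs n B).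
Proof.
apply: All_map => g; rewrite mem_iota add0n /= => ltg; rewrite /sound /=.
have [/allP wf _] := andP wfB.
have wfg : gate_wf (n + g) (nth (GNot 0) (gates B) g).
  by apply: wf; rewrite mem_iota.
have := @nth_wires_gate (gates B) input_string g; rewrite size_mkseq => -> //.
case: (nth _ _ g) => [i|i j|i j] /=; rewrite !B_wireE !simp_const.
- by case: (nth _ _ i).
- by case: (nth _ _ i); case: (nth _ _ j).
- by case: (nth _ _ i); case: (nth _ _ j).
Qed.

Let C_defs_sound (z : n.-tuple bool) : All sound (C_defs n s z).
Proof.
apply: All_map => g; rewrite mem_iota add0n /= => ltg; rewrite /sound /=.
have := @nth_wires_gate gs z g; rewrite size_tuple size_gs => -> //; last exact: wf_gs.
have wfg := wf_gs ltg.
rewrite (@C_selectE z (n + g) (VCleft g) (gate_left (nth (GNot 0) gs g))) //; last first.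
  by case: (nth _ _ g) wfg => //= ? ? /andP[].
rewrite (@C_selectE z (n + g) (VCright g) (gate_right (nth (GNot 0) gs g))) //; last first.
  by case: (nth _ _ g) wfg => //= ? ? /andP[].
case: (nth _ _ g) => [i|i j|i j] /=; rewrite !simp_const.
- by case: (nth _ _ i).
- by case: (nth _ _ i); case: (nth _ _ j).
- by case: (nth _ _ i); case: (nth _ _ j).
Qed.

Lemma alpha_defs_sound :
  All sound (B_defs n B ++ sat_defs n fX fY VSatY ++ sat_defs n fX (fB n B) VSatB ++
             flatten [seq C_defs n s (tval z) | z <- enum A]).
Proof.
apply: All_cat; first exact: B_defs_sound.
apply: All_cat; first exact: (@sat_defs_sound _ _ _ _ _ _ ts y_form).
apply: All_cat; last by apply: All_flatten => z _; apply: C_defs_sound.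
exact: (@sat_defs_sound _ _ _ _ _ _ ts (fun i => Const nat (B_output i))).
Qed.

Let simp_bigAnd_top fs : All (fun f => simp (subst asg f) = Top) fs ->
  simp (subst asg (bigAnd fs)) = Top.
Proof. by elim: fs => //= f fs IHfs [-> /IHfs ->]. Qed.

Let simp_bigOr_bot fs : All (fun f => simp (subst asg f) = Bot) fs ->
  simp (subst asg (bigOr fs)) = Bot.
Proof. by elim: fs => //= f fs IHfs [-> /IHfs ->]. Qed.

Let exactly_oneE m p l : l < m -> (forall w, asg (p w) = Const nat (w == l)) ->
  simp (subst asg (exactly_one m (fun w => Var (p w)))) = Top.
Proof.
move=> ltl pE; rewrite /exactly_one [subst _ _]/= [simp _]/=.
rewrite (@simp_subst_bigOr_pick _ _ _ _ _ l) /=.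
- rewrite pE eqxx /=; apply: simp_bigAnd_top; apply: All_flatten => j _.
  apply: All_map => i; rewrite mem_iota /= !pE => ltij.
  (* As [i < j], they cannot both be [l]. *)
  by case: (eqVneq i l) => [ei|_]; case: (eqVneq j l) => [ej|_] //=; lia.
- exact: iota_uniq.
- by rewrite mem_iota.
- by move=> w _ /negPf ne; rewrite pE ne.
Qed.

Let C_validE : simp (subst asg (C_valid n s)) = Top.
Proof.
have andE f h : simp (subst asg (And f h)) =
  simp_and (simp (subst asg f)) (simp (subst asg h)) by [].
rewrite /C_valid andE (@exactly_oneE _ _ o) // simp_bigAnd_top //.
apply: All_map => g; rewrite mem_iota add0n => /andP[_ ltg].
have wfg := wf_gs ltg.
have lt_left : gate_left (nth (GNot 0) gs g) < n + g.
  by case: (nth _ _ g) wfg => //= ? ? /andP[].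
have lt_right : gate_right (nth (GNot 0) gs g) < n + g.
  by case: (nth _ _ g) wfg => //= ? ? /andP[].
by rewrite andE (exactly_oneE lt_left) // (exactly_oneE lt_right).
Qed.

(** The premise [C_valid] becomes [Top], the disagreements on [A] and [sat_out n VSatB] become
    [Bot], and [sat_out n VSatY] becomes the normal form of [Neg g]; an implication from it to [Bot]
    is its negation. *)
Lemma alpha_body_simp f g :
  parse_state ts (n %/ 3) = (0, [:: Neg f]) -> tautology f -> subst y_form f = g ->
  simp (subst asg (Imp (C_valid n s)
      (Or (Imp (sat_out n VSatY) (sat_out n VSatB))
          (bigOr [seq Neg (Equiv (fC n s (tval z)) (Const avar (SATn z)))
                 | z <- enum A])))) = simp (Neg (Neg g)).
Proof.
move=> stT tf fg.
have outY := @sat_out_simp _ n VSatY asg ts y_form size_ts ts_ok (fun=> erefl) _ _ stT.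
have outB := @sat_out_simp _ n VSatB asg ts _ size_ts ts_ok (fun=> erefl) _ _ stT.
have impE h h' : simp (subst asg (Imp h h')) =
  simp_or (simp_neg (simp (subst asg h))) (simp (subst asg h')) by [].
have orE h h' : simp (subst asg (Or h h')) =
  simp_or (simp (subst asg h)) (simp (subst asg h')) by [].
rewrite !(impE, orE) C_validE outY outB simp_bigOr_bot; last first.
  apply: All_map => z _ /=; rewrite subst_const simp_const.
  by rewrite (@C_selectE z _ _ o) // gs_correct; case: (SATn z).
by rewrite (simp_subst_const _ (Neg f)) /= tf /= fg !simp_or_bot.
Qed.

Lemma fsize_alpha_assign a : fsize (alpha_assign a) <= n.+1.
Proof.
have szC b : fsize (Const nat b) <= 1 by case: b.
have szT : (size ts).+1 <= n.+1 by rewrite size_ts ltnS leq_div.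
by case: a => * //=; do ?[exact: leq_trans (szC _) _
                        |exact: leq_trans (fsize_sat_assign _ ts_ok _) szT].
Qed.

End AlphaInstance.

(** * The size of alpha *)

Section FormulaSizes.
Variable V : Type.
Implicit Types (f g : form V) (fs : seq (form V)).

Lemma fsize_and f g : fsize (And f g) = (fsize f + fsize g).+1.
Proof. by []. Qed.

Lemma fsize_or f g : fsize (Or f g) = (fsize f + fsize g).+1.
Proof. by []. Qed.

Lemma fsize_neg f : fsize (Neg f) = (fsize f).+1.
Proof. by []. Qed.

Lemma fsize_imp f g : fsize (Imp f g) = (fsize f + fsize g).+2.
Proof. by []. Qed.

Lemma fsize_equiv f g : fsize (Equiv f g) = 2 * fsize f + 2 * fsize g + 5.
Proof. by rewrite /=; lia. Qed.

Lemma fsize_const b : fsize (Const V b) = 1.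
Proof. by case: b. Qed.

Lemma fsize_bigOr fs M :
  All (fun f => fsize f <= M) fs -> fsize (bigOr fs) <= size fs * M.+1 + 1.
Proof. by elim: fs => //= f fs IHfs [sf /IHfs]; rewrite mulSn; lia. Qed.

Lemma fsize_bigAnd fs M :
  All (fun f => fsize f <= M) fs -> fsize (bigAnd fs) <= size fs * M.+1 + 1.
Proof. by elim: fs => //= f fs IHfs [sf /IHfs]; rewrite mulSn; lia. Qed.

(** An equivalence with a variable has size at most [2 * E + 7], and the implication adds two
    symbols. *)
Lemma fsize_with_defs (ds : seq (V * form V)) f E :
  All (fun d => fsize d.2 <= E) ds ->
  fsize (with_defs ds f) <= size ds * (2 * E + 9) + fsize f.
Proof. by elim: ds => //= d ds IHds [sd /IHds]; rewrite mulSn; lia. Qed.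

End FormulaSizes.

Lemma size_flatten_map (T : Type) (I : eqType) (F : I -> seq T) r m :
  (forall i, i \in r -> size (F i) <= m) ->
  size (flatten [seq F i | i <- r]) <= size r * m.
Proof.
elim: r => //= i r IHr szF; rewrite size_cat mulSn.
apply: leq_add; first by apply: szF; rewrite inE eqxx.
by apply: IHr => j jr; apply: szF; rewrite inE jr orbT.
Qed.

Section SatSizes.
Variables (V : Type) (n q : nat) (x y : nat -> form V) (aux : satvar -> V).
Hypothesis x1 : forall i, fsize (x i) <= 1.
Hypothesis y1 : forall i, fsize (y i) <= 1.
Hypothesis le_q : n <= q.

Let leT : n %/ 3 <= q.
Proof. by apply: leq_trans le_q; rewrite leq_div. Qed.

Let fsize_cell t j : [/\ fsize (tick_idx n aux t j) = 1, fsize (cell_occ n aux t j) = 1 &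
  fsize (cell_val n aux t j) = 1].
Proof. by rewrite /tick_idx /cell_occ /cell_val; case: ifP. Qed.

Let fsize_token_case t F M : (forall k, fsize (F k) <= M) ->
  fsize (token_case x t F) <= 8 * (M + 10) + 1.
Proof.
move=> FM.
have lit b i : fsize (Lit b (x i)) <= 2 by have := x1 i; case: b => /=; lia.
have tok k : fsize (is_token x t k) <= 8.
  rewrite /is_token; case: (token_bits k) => [[a b] c] /=.
  by have := lit a (3 * t); have := lit b (3 * t).+1; have := lit c (3 * t).+2; lia.
have := @fsize_bigOr _ [seq And (is_token x t k) (F k) | k <- tokens] (M + 9).
rewrite size_map -addnS; apply.
elim: tokens => // k ks IHks; split; last exact: IHks.
by rewrite fsize_and; have := FM k; have := tok k; lia.
Qed.

(** The bound is shared with the other definitions of [alpha]; [40 * q] is dictated by [C_gate],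
    which contains five selections of size at most [8 * q + 1]. *)
Lemma fsize_sat_defs : All (fun d => fsize d.2 <= 40 * q + 140) (sat_defs n x y aux).
Proof.
have tidx t j : fsize (tick_idx n aux t j) = 1 by case: (fsize_cell t j).
have occ t j : fsize (cell_occ n aux t j) = 1 by case: (fsize_cell t j).
have val t j : fsize (cell_val n aux t j) = 1 by case: (fsize_cell t j).
have rvar t : fsize (read_var n y aux t) <= 4 * q + 1.
  apply: leq_trans (@fsize_bigOr _ _ 3 _) _; last by rewrite size_map size_iota; lia.
  by apply: All_map => i _ /=; rewrite tidx; have := y1 i; lia.
apply: All_cat; first split; first by rewrite /=; lia.
  by apply: All_cat; last apply: All_cat; apply: All_map => i _ /=; rewrite ?fsize_const; lia.
apply: All_flatten => t _; split; last apply: All_cat; last apply: All_cat.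
- have tc := @fsize_token_case t (next_ok n aux t) 1.
  rewrite fsize_and [fsize (Var _)]/=.
  suff : fsize (token_case x t (next_ok n aux t)) <= 8 * (1 + 10) + 1 by lia.
  by apply: tc; case=> //=; rewrite ?occ.
- apply: All_map => i _.
  apply: leq_trans (@fsize_token_case t (next_idx n aux t i) 1 _) _; last by lia.
  by case=> //=; rewrite ?tidx ?fsize_const //; case: i => //= i; rewrite tidx.
- apply: All_map => j _.
  apply: leq_trans (@fsize_token_case t (next_occ n aux t j) 1 _) _; last by lia.
  by case=> //=; rewrite ?occ //; case: j => //= j; rewrite occ.
- apply: All_map => j _.
  apply: leq_trans (@fsize_token_case t (next_val n y aux t j) (4 * q + 3) _) _.
    by case; case: j => [|j] /=; rewrite ?val ?addn1 //; have := rvar t; lia.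
  by lia.
Qed.

(** There are at most [1 + q] stages, each with one flag and three rows of at most [q] variables. *)
Lemma size_sat_defs : size (sat_defs n x y aux) <= (1 + 3 * q) * (1 + q).
Proof.
rewrite /sat_defs size_cat mulnDr muln1; apply: leq_add.
  by rewrite /= !size_cat !size_map size_iota; lia.
apply: leq_trans (size_flatten_map (m := 1 + 3 * q) _) _.
  by move=> t _; rewrite /= !size_cat !size_map size_iota; lia.
by rewrite size_iota mulnC leq_mul2l leT orbT.
Qed.

Lemma fsize_sat_out : fsize (sat_out n aux) = 8.
Proof.
rewrite /sat_out /=.
have [_ -> _] := fsize_cell (n %/ 3) 0; have [_ -> _] := fsize_cell (n %/ 3) 1.
by have [_ _ ->] := fsize_cell (n %/ 3) 0.
Qed.

End SatSizes.

(** The first product counts the definitions (gates of [B], two runs of the parser, gates of [C] on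
    each string of [A]) times the cost of one. The rest covers [C_valid], the two parser outputs and
    the disjunction over [A]. *)
Definition alpha_bound (q : nat) : nat :=
  (q + 2 * ((1 + 3 * q) * (1 + q)) + q * q) * (2 * (40 * q + 140) + 9) +
  (2 * q + 1) * (40 * (q * q) + 20 * q + 20) + 20 + q * (16 * q + 15).

Lemma fsize_alpha n s (A : {set n.-tuple bool}) B q :
  n <= q -> s <= q -> csize B <= q -> #|A| <= q ->
  fsize (alpha s A B) <= alpha_bound q.
Proof.
move=> nq sq Bq Aq; rewrite /alpha.
have bw w : fsize (B_wire n w) = 1 by rewrite /B_wire; case: ifP.
have cw z w : fsize (C_wire n z w) = 1.
  by rewrite /C_wire; case: ifP; rewrite ?fsize_const.
have csel z m p : m <= 2 * q -> fsize (C_select n z m p) <= 8 * q + 1.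
  move=> le_m; apply: leq_trans (@fsize_bigOr _ _ 3 _) _.
    by apply: All_map => w _ /=; rewrite cw.
  by rewrite size_map size_iota; lia.
have exo m p : m <= 2 * q ->
    fsize (exactly_one m (fun w => Var (p w))) <= 20 * (q * q) + 4 * q + 3.
  move=> le_m; rewrite /exactly_one.
  have b1 : fsize (bigOr [seq (Var (p i) : form avar) | i <- iota 0 m]) <= m * 2 + 1.
    apply: leq_trans (@fsize_bigOr _ _ 1 _) _; last by rewrite size_map size_iota.
    exact: All_map.
  have b2 : fsize (bigAnd [seq Neg (And (Var (p i)) (Var (p j)))
      | j <- iota 0 m, i <- iota 0 j]) <= m * m * 5 + 1.
    apply: leq_trans (@fsize_bigAnd _ _ 4 _) _.
      by apply: All_flatten => j _; apply: All_map.
    rewrite leq_add2r leq_mul2r /=.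
    apply: leq_trans (size_flatten_map (m := m) _) _; last by rewrite size_iota.
    by move=> j; rewrite mem_iota size_map size_iota; lia.
  have mm : m * m <= 4 * (q * q) by nia.
  apply: (@leq_trans (m * 2 + 1 + (m * m * 5 + 1)).+1); last by lia.
  by rewrite fsize_and ltnS; apply: leq_add b1 b2.
set ds := _ ++ _; set body := Imp _ _.
have sds : size ds <= q + 2 * ((1 + 3 * q) * (1 + q)) + q * q.
  rewrite /ds (size_cat (B_defs n B)) (size_cat (sat_defs n fX fY VSatY)).
  rewrite (size_cat (sat_defs n fX (fB n B) VSatB)).
  have s1 : size (B_defs n B) <= q by rewrite size_map size_iota.
  have s2 := @size_sat_defs avar n q fX fY VSatY nq.
  have s3 := @size_sat_defs avar n q fX (fB n B) VSatB nq.
  have s4 : size (flatten [seq C_defs n s (tval z) | z <- enum A]) <= q * q.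
    apply: leq_trans (size_flatten_map (m := q) _) _.
      by move=> z _; rewrite size_map size_iota.
    by rewrite -cardE leq_mul2r Aq orbT.
  by lia.
have fds : All (fun d => fsize d.2 <= 40 * q + 140) ds.
  rewrite /ds; apply: All_cat; last apply: All_cat; last apply: All_cat.
  - by apply: All_map => g _ /=; case: (nth _ _ _) => * /=; rewrite !bw; lia.
  - exact: fsize_sat_defs.
  - apply: fsize_sat_defs => // i.
    by rewrite /fB; case: ifP => //; rewrite bw.
  - apply: All_flatten => z _; apply: All_map => g; rewrite mem_iota => ltg.
    have le_m : n + g <= 2 * q by lia.
    have := csel z _ (VCleft g) le_m; have := csel z _ (VCright g) le_m.
    by rewrite /C_gate /=; lia.
have sbody : fsize body <= (2 * q + 1) * (40 * (q * q) + 20 * q + 20) + 20 +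
    q * (16 * q + 15).
  have sv : fsize (C_valid n s) <=
      q * (2 * (20 * (q * q) + 4 * q + 3) + 2) + (20 * (q * q) + 4 * q + 3) + 2.
    rewrite /C_valid fsize_and.
    have := exo (n + s) VCout; set b := fsize (exactly_one _ _) => /(_ _) sb.
    have {}sb : b <= 20 * (q * q) + 4 * q + 3 by apply: sb; lia.
    set fs := map _ _.
    have : fsize (bigAnd fs) <= q * (2 * (20 * (q * q) + 4 * q + 3) + 2) + 1.
      apply: leq_trans (@fsize_bigAnd _ _ (2 * (20 * (q * q) + 4 * q + 3) + 1) _) _.
        apply: All_map => g; rewrite mem_iota => ltg.
        have le_m : n + g <= 2 * q by lia.
        rewrite fsize_and.
        by have := exo _ (VCleft g) le_m; have := exo _ (VCright g) le_m; lia.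
      by rewrite size_map size_iota; nia.
    by lia.
  have so : fsize (bigOr [seq Neg (Equiv (fC n s (tval z)) (Const avar (SATn z)))
      | z <- enum A]) <= q * (16 * q + 11) + 1.
    apply: leq_trans (@fsize_bigOr _ _ (16 * q + 10) _) _.
      apply: All_map => z _; rewrite fsize_neg fsize_equiv fsize_const.
      have le_m : n + s <= 2 * q by lia.
      apply: (@leq_trans (2 * (8 * q + 1) + 2 * 1 + 5).+1); last by lia.
      by rewrite ltnS !leq_add2r leq_mul2l; apply: csel.
    by rewrite size_map -cardE leq_add2r -addnS leq_mul2r Aq orbT.
  rewrite /body fsize_imp fsize_or fsize_imp !fsize_sat_out.
  by nia.
apply: leq_trans (fsize_with_defs _ fds) _.
rewrite /alpha_bound -addnA -addnA; apply: leq_add; last by lia.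
by rewrite leq_mul2r sds orbT.
Qed.

(** * Polynomially bounded functions *)

(** The base is at least 2, so constants and sums are absorbed by raising the exponent. *)
Definition poly_bounded (F : nat -> nat) : Prop := exists c, forall m, F m <= m.+2 ^ c.

Lemma poly_bounded_const a : poly_bounded (fun=> a).
Proof.
exists a => m; apply: leq_trans (ltnW (ltn_expl a (isT : 1 < 2))) _.
by case: a => // a; rewrite leq_exp2r.
Qed.

Lemma poly_bounded_id : poly_bounded id.
Proof. by exists 1 => m; rewrite expn1; lia. Qed.

Lemma poly_bounded_mul F G :
  poly_bounded F -> poly_bounded G -> poly_bounded (fun m => F m * G m).
Proof.
by move=> [c Fc] [d Gd]; exists (c + d) => m; rewrite expnD leq_mul.
Qed.

Lemma poly_bounded_add F G :
  poly_bounded F -> poly_bounded G -> poly_bounded (fun m => F m + G m).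
Proof.
move=> [c Fc] [d Gd]; exists (c + d).+1 => m; rewrite expnS expnD.
have : 0 < m.+2 ^ c by rewrite expn_gt0.
have : 0 < m.+2 ^ d by rewrite expn_gt0.
by have := Fc m; have := Gd m; nia.
Qed.

Lemma poly_bounded_exp F k : poly_bounded F -> poly_bounded (fun m => F m ^ k).
Proof.
move=> bF; elim: k => [|k IHk]; first exact: (poly_bounded_const 1).
have [c Fc] := poly_bounded_mul bF IHk.
by exists c => m; rewrite expnS.
Qed.

Lemma poly_bounded_poly_bound F : poly_bounded F ->
  exists c, forall m, F m <= poly_bound c m.
Proof.
(* The summand [3 ^ c] handles [m = 0] and [m = 1]; from 2 on, [m + 2 <= m ^ 2], whence the exponent
   [2 * c]. *)
move=> [c Fc]; exists (3 ^ c + 2 * c) => m; apply: leq_trans (Fc m) _.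
rewrite /poly_bound; case: m => [|[|m]].
- apply: leq_trans (leq_addl _ _); apply: leq_trans (leq_addr _ _).
  by case: c {Fc} => // c; rewrite leq_exp2r.
- by apply: leq_trans (leq_addl _ _); apply: leq_addr.
apply: leq_trans (leq_addr _ _); rewrite expnD.
apply: (@leq_trans (m.+2 ^ (2 * c))); last by rewrite leq_pmull // expn_gt0.
by rewrite expnM; case: c {Fc} => // c; rewrite leq_exp2r // expnS expn1; nia.
Qed.

(** * Deriving a tautology from one instance of [alpha] *)

Lemma bounded_from_alpha_instance : exists c,
  forall k n0 (A : forall n, {set n.-tuple bool}) (B : nat -> circuit) n q phi,
  tautology phi -> n0 <= n -> 0 < n -> circuit_wf n (B n) ->
  in_Circuit (n ^ k) (@SATn n) -> fsize phi * (fsize phi).+1 < n %/ 3 ->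
  n <= q -> n ^ k <= q -> csize (B n) <= q -> #|A n| <= q ->
  let Z := alpha_bound q * n.+1 in
  bounded (alpha_instance k n0 A B) (c * Z) (c * (Z * Z)) phi.
Proof.
have [c bc] := bounded_with_eqs; exists c => k n0 A B n q phi tphi le_n n_gt0 wfB.
move=> [C [wfC outC szC] Ccorrect] lt_T le_q1 le_q2 le_q3 le_q4 Z.
set s := n ^ k in szC le_q2.
pose vs := vars phi; pose f := reindex vs phi; pose ts := padded_encode (n %/ 3) (Neg f).
(* The strict inequality on [n %/ 3] leaves room for the token [TNeg]. *)
have le_T : size (encode (Neg f)) <= n %/ 3.
  rewrite /= size_rcons; apply: leq_trans lt_T; rewrite ltnS.
  apply: leq_trans (size_encode_reindex _ _) _.
  by rewrite leq_mul2l ltnS size_vars orbT.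
have [size_ts ts_ok stT] := padded_encode_ok le_T.
(* [alpha] describes circuits with exactly [s] gates, so [C] is padded with negations of wire 0,
   which exists because [0 < n]. *)
pose gs := gates C ++ nseq (s - csize C) (GNot 0); pose o := head 0 (outs C).
have [/allP wf_gates /allP wf_outs] := andP wfC.
have outsE : outs C = [:: o] by rewrite /o; case: (outs C) outC => [|? []].
have lt_oC : o < n + csize C by apply: wf_outs; rewrite outsE inE.
have size_gs : size gs = s by rewrite size_cat size_nseq subnKC.
have wf_gs g : g < s -> gate_wf (n + g) (nth (GNot 0) gs g).
  move=> ltg; rewrite /gs nth_cat; case: ltnP => [ltgC|leCg].
    by apply: wf_gates; rewrite mem_iota.
  by rewrite nth_nseq if_same /= ltn_addr.
have lt_o : o < n + s by lia.
have gs_correct (z : n.-tuple bool) : nth false (wires gs z) o = SATn z.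
  rewrite -Ccorrect /ceval1 /ceval outsE /=.
  by rewrite nth_wires_cat // size_tuple.
pose asg := alpha_assign n (B n) gs o ts vs.
have tf : tautology f by move=> v; rewrite eval_reindex.
have body := @alpha_body_simp n s (A n) (B n) gs o ts vs size_ts ts_ok wfB size_gs
  wf_gs lt_o gs_correct _ _ stT tf (reindexK (fun _ h => h)).
have Hinst : alpha_instance k n0 A B (subst asg (alpha s (A n) (B n))).
  by exists n, asg.
have sZ : fsize (subst asg (alpha s (A n) (B n))) <= Z.
  apply: leq_trans (fsize_subst _ (ltn0Sn n) _) _; last first.
    by rewrite leq_mul2r fsize_alpha.
  exact: (fsize_alpha_assign (B n) gs o vs size_ts ts_ok).
have sphi : fsize phi <= Z.
  have le_phi : fsize phi <= n.
    apply: leq_trans (leq_div n 3); apply: leq_trans (ltnW lt_T).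
    by rewrite leq_pmulr.
  apply: leq_trans le_phi _; apply: leq_trans (leqnSn n) _.
  by rewrite leq_pmull // /alpha_bound; lia.
move: Hinst sZ; rewrite /alpha subst_with_defs => Hinst sZ.
apply: (bc _ _ _ _ _ Hinst _ body sZ sphi).
have := @alpha_defs_sound n s (A n) (B n) gs o ts vs size_ts ts_ok wfB size_gs wf_gs.
by move: (_ ++ _); elim=> //= d ds IHds [sd /IHds].
Qed.

(** * Choice of parameters and the circuit lower bound *)

Theorem theorem1p5 (k : nat) (hk : 3 <= k) (n0 c : nat)
    (A : forall n : nat, {set n.-tuple bool}) (B' B : nat -> circuit)
    (hA : forall n : nat, n0 <= n -> antichecker_choice (n ^ k) c (A n))
    (hB' : forall n : nat, n0 <= n -> decider_choice n (n ^ k) (B' n))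
    (hB : forall n : nat, n0 <= n -> searcher_choice n (n ^ k) c (B' n) (B n)) :
  (exists phi : nat -> form nat,
     (forall i : nat, tautology (phi i)) /\
     ~ poly_size_derivations (alpha_instance k n0 A B) phi) ->
  forall N : nat, exists n : nat,
    N <= n /\ ~ in_Circuit (n ^ k) (@SATn n).
Proof.
move=> [phi [tphi no_short]] N; apply: NNPP => no_n; apply: no_short.
have easy n : N <= n -> in_Circuit (n ^ k) (@SATn n).
  by move=> le_N; apply: NNPP => hard; apply: no_n; exists n.
have [d bd] := bounded_from_alpha_instance.
(* A multiple of 3, so that [n_of m %/ 3] exceeds [m * m.+1], the length allowed for the code of a
   tautology of size [m]; [N] and [n0] put [n_of m] in the range where the assumptions hold. *)
pose n_of m := 3 * (N + n0 + m * m.+1 + 1).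
(* One bound for the input length, the size of [C], the size of [B] and the cardinality of [A]. *)
pose q_of m := n_of m + n_of m ^ k + poly_bound c (n_of m ^ k).
pose Z_of m := alpha_bound (q_of m) * (n_of m).+1.
(* The left side is the number of lines times the line size, as in [bounded_derivation]. *)
have [e be] : exists e, forall m,
    d * (Z_of m * Z_of m) * (d * Z_of m) <= poly_bound e m.
  apply: poly_bounded_poly_bound.
  have bn : poly_bounded n_of.
    apply: poly_bounded_mul (poly_bounded_const _) _.
    apply: poly_bounded_add (poly_bounded_const _).
    apply: poly_bounded_add (poly_bounded_const _) _.
    apply: poly_bounded_mul poly_bounded_id _.
    by exists 1 => m; rewrite expn1.
  have bs := poly_bounded_exp k bn.
  have bq : poly_bounded q_of.
    apply: poly_bounded_add (poly_bounded_add bn bs) _.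
    exact: poly_bounded_add (poly_bounded_exp c bs) (poly_bounded_const c).
  have bZ : poly_bounded Z_of.
    apply: poly_bounded_mul; last first.
      by have [a ba] := poly_bounded_add bn (poly_bounded_const 1);
        exists a => m; rewrite -addn1.
    by rewrite /alpha_bound; repeat first [exact: bq | exact: poly_bounded_const
      | apply: poly_bounded_add | apply: poly_bounded_mul].
  apply: poly_bounded_mul; apply: poly_bounded_mul (poly_bounded_const d) _ => //.
  exact: poly_bounded_mul.
exists e => i; set m := fsize (phi i).
have le_n : n0 <= n_of m by rewrite /n_of; lia.
have le_N : N <= n_of m by rewrite /n_of; lia.
have n_gt0 : 0 < n_of m by rewrite /n_of; lia.
have [cardA _] := hA _ le_n; have [wfB _ szB _] := hB _ le_n.
have := bd k n0 A B (n_of m) (q_of m) (phi i) (tphi i) le_n n_gt0 wfB (easy _ le_N).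
case/(_ _ _ _ _ _)/bounded_derivation.
- by rewrite /n_of mulKn // -/m; lia.
- by rewrite /q_of -addnA leq_addr.
- by rewrite /q_of addnAC leq_addl.
- by apply: leq_trans szB _; rewrite leq_addl.
- by apply: leq_trans cardA _; rewrite leq_addl.
move=> p [dp szp]; exists p; split=> //.
exact: leq_trans szp (be m).
Qed.
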